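(* Consider any one of the four Bayesian generalized linear models described in the context (Poisson, negative-binomial, logistic, or probit regression) with prior $\beta\sim\mathrm{N}_d(0,\alpha^{-1}C)$, negative log-likelihood $\ell_n$, posterior $\Pi(\cdot\mid X,Y)$ with normalizing constant $Z_{\Pi(\cdot|X,Y)}$, and unique posterior density maximizer $\beta^*$. Let $P$ be the Metropolis-Hastings independence kernel with target $\Pi(\cdot\mid X,Y)$ and proposal $\mathrm{N}_d(\beta^*,\alpha^{-1}C)$. Then for every lower semicontinuous metric $\rho$ on $\mathbb{R}^d$ and every integer $t\ge1$, $$\mathcal{W}_\rho\left(P^t(\beta^*,\cdot),\Pi(\cdot\mid X,Y)\right) = (1-\epsilon_{\beta^*})^t\int\rho(\beta,\beta^* )\,d\Pi(\beta\mid X,Y),$$ where $$\epsilon_{\beta^*} = \frac{\exp\left(\ell_n(\beta^* )+\frac{\alpha}{2}{\beta^*}^T C^{-1}\beta^*\right) Z_{\Pi(\cdot|X,Y)}}{(2\pi)^{d/2}\det(\alpha^{-1}C)^{1/2}}.$$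
   Context: Models: there are $n$ discrete-valued responses $Y_i$ with features $X_i\in\mathbb{R}^d$ and a parameter $\beta\in\mathbb{R}^d$; the $Y_i$ are conditionally independent given the features and $\beta$, with one of the following: (i) Poisson regression: $Y_i\mid X_i,\beta\sim\mathrm{Poisson}(\exp(\beta^T X_i))$; (ii) negative-binomial regression: $Y_i\mid X_i,\beta\sim\text{Negative-Binomial}\left(\xi,(1+\exp(-\beta^T X_i))^{-1}\right)$ with fixed $\xi\in(0,+\infty)$, where Negative-Binomial$(\xi,p)$ has mass function $y\mapsto\frac{\Gamma(y+\xi)}{y!\,\Gamma(\xi)}p^y(1-p)^\xi$ on $\{0,1,2,\dots\}$; (iii) logistic regression: $Y_i\mid X_i,\beta\sim\mathrm{Bernoulli}(S(\beta^T X_i))$ with $S(x)=(1+\exp(x))^{-1}$; (iv) probit regression: $Y_i\mid X_i,\beta\sim\mathrm{Bernoulli}(S(\beta^T X_i))$ with $S$ the cumulative distribution function of a standard Gaussian. The prior is $\beta\sim\mathrm{N}_d(0,\alpha^{-1}C)$ with known $\alpha\in(0,+\infty)$ and known symmetric positive-definite $C\in\mathbb{R}^{d\times d}$. Write $Y=(Y_1,\dots,Y_n)^T$, $X=(X_1,\dots,X_n)^T$, both held fixed. With $\ell_n(\beta)$ the negative log-likelihood of the chosen model, the posterior $\Pi(\cdot\mid X,Y)$ has density $$\pi(\beta\mid X,Y) = Z_{\Pi(\cdot|X,Y)}^{-1}\exp\left(-\ell_n(\beta)-\frac{\alpha}{2}\beta^T C^{-1}\beta\right).$$ In all four models $\ell_n$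 is convex, and $\beta^*$ is the unique maximizer of $\pi(\cdot\mid X,Y)$. Metropolis-Hastings independence (MHI) kernel on $\mathbb{R}^d$ with strictly positive target density $\pi$ and strictly positive proposal density $q$ (proposal assumed different from the target): let $a(\theta,\theta') = \min\left\{ \frac{\pi(\theta') q(\theta)}{\pi(\theta) q(\theta')}, 1\right\}$ and for measurable $B\subseteq\mathbb{R}^d$ $$P(\theta, B) = \int_B a(\theta,\theta') q(\theta')\, d\theta' + \delta_\theta(B)\left(1 - \int a(\theta,\theta') q(\theta')\, d\theta'\right),$$ where $\delta_\theta$ is the Dirac measure at $\theta$; $P^1=P$ and $P^t(\theta,B) = \int P(\theta,d\theta')P^{t-1}(\theta',B)$ for $t\ge 2$. Wasserstein distance: for a lower semicontinuous metric $\rho$ on $\mathbb{R}^d$ (lower semicontinuous on $\mathbb{R}^d\times\mathbb{R}^d$ with the Euclidean topology), $\mathcal{W}_\rho(\mu,\nu) = \inf_{\xi\in\mathcal{C}(\mu,\nu)}\int\rho\,d\xi$, where $\mathcal{C}(\mu,\nu)$ is the set of joint probability measures with marginals $\mu$ and $\nu$. Values in $[0,+\infty]$ are allowed. *)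

(* Defs.v *)
From HB Require Import structures.
From mathcomp Require Import all_boot all_order all_algebra.
From mathcomp Require Import all_classical all_reals all_analysis.
From mathcomp Require Import measurable_realfun.

Set Implicit Arguments.
Unset Strict Implicit.
Unset Printing Implicit Defensive.

Import Order.TTheory GRing.Theory Num.Theory.
Import numFieldNormedType.Exports.

Local Open Scope classical_set_scope.
Local Open Scope ring_scope.

(* R^d is 'cV[R]_d.  Its library topology is that of the sup norm, which is the
   Euclidean one; it carries the Borel sigma-algebra of that topology. *)
Section borel_matrix.
Variables (R : realType) (m n : nat).
Let B := @open 'M[R]_(m, n).

HB.instance Definition _ :=
  @isMeasurable.Build (sigma_display B) 'M[R]_(m, n) <<s B >>
    (@sigma_algebra0 _ setT B) (@sigma_algebraC _ B)
    (@sigma_algebra_bigcup _ setT B).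
End borel_matrix.

Section lebesgue_measure_cV.
Variable R : realType.

Definition cons_cV (d : nat) (p : R * 'cV[R]_d) : 'cV[R]_d.+1 :=
  col_mx (p.1%:M : 'cV[R]_1) p.2.

Definition uncons_cV (d : nat) (v : 'cV[R]_d.+1) : R * 'cV[R]_d :=
  (v ord0 ord0, \col_i v (lift ord0 i) ord0).

Lemma cons_cV0 d (p : R * 'cV[R]_d) : cons_cV p ord0 ord0 = p.1.
Proof.
have -> : ord0 = lshift d (ord0 : 'I_1) :> 'I_(1 + d) by apply/val_inj.
by rewrite /cons_cV (@col_mxEu _ 1 d 1) mxE.
Qed.

Lemma cons_cV_lift d (p : R * 'cV[R]_d) i :
  cons_cV p (lift ord0 i) ord0 = p.2 i ord0.
Proof. by rewrite -rshift1 /cons_cV (@col_mxEd _ 1 d 1). Qed.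

Lemma cons_cVK d : cancel (@cons_cV d) (@uncons_cV d).
Proof.
move=> p; rewrite /uncons_cV cons_cV0 [RHS]surjective_pairing; congr pair.
by apply/colP => i; rewrite mxE cons_cV_lift.
Qed.

Lemma measurable_uncons_cV d : measurable_fun setT (@uncons_cV d).
Proof.
apply/measurable_fun_pairP; split.
  apply: (measurability _ (RGenOpens.measurableE R)).
  move=> _ [_ [a [b ->]] <-]; rewrite setTI; apply: sub_sigma_algebra.
  have /continuousP := @coord_continuous R d.+1 1 ord0 ord0.
  by apply; exact: interval_open.
apply: (measurability (@open 'cV[R]_d)) => // _ [U oU <-].
rewrite setTI; apply: sub_sigma_algebra.
move: U oU; apply/continuousP => v A /= /nbhs_ballP[e e0 eA].
apply/nbhs_ballP; exists e => //= w [_ vw]; apply: eA; split => // i j.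
by rewrite !mxE; exact: vw.
Qed.

Lemma measurable_cons_cV d : measurable_fun setT (@cons_cV d).
Proof.
apply: (measurability (@open 'cV[R]_d.+1)) => // _ [U oU <-]; rewrite setTI.
pose r (k : nat) : R := k.+1%:R^-1.
pose c (q : 'cV[rat]_d.+1) : 'cV[R]_d.+1 := map_mx ratr q.
pose F (q : 'cV[rat]_d.+1 * nat) : set (R * 'cV[R]_d) :=
  if `[< ball (c q.1) (r q.2) `<=` U >]
  then ball (uncons_cV (c q.1)).1 (r q.2) `*`
       ball (uncons_cV (c q.1)).2 (r q.2) else set0.
have r0 k : 0 < r k by rewrite invr_gt0.
have FE p q : ball (c q.1) (r q.2) (cons_cV p) <->
    (ball (uncons_cV (c q.1)).1 (r q.2) `*`
       ball (uncons_cV (c q.1)).2 (r q.2)) p.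
  split=> [[_ h]|[h0 [_ h]]].
    split; first by move: (h ord0 ord0); rewrite cons_cV0.
    split=> // i j; rewrite ord1 mxE.
    by move: (h (lift ord0 i) ord0); rewrite cons_cV_lift.
  split=> // i j; rewrite ord1; case: (unliftP ord0 i) => [k ->|->].
    by rewrite cons_cV_lift; move: (h k ord0); rewrite mxE.
  by rewrite cons_cV0.
have -> : @cons_cV d @^-1` U = \bigcup_q F q.
  apply/seteqP; split => [p Up|p [q _]]; last first.
    by rewrite /F; case: asboolP => // qU /FE; exact: qU.
  have /nbhs_ballP[e e0 eU] := open_nbhs_nbhs (conj oU Up).
  have [k /= ke] : exists k, r k < e / 2.
    have [k _ /(_ _ (leqnn k))] := near_infty_natSinv_lt (PosNum (divr_gt0 e0 (ltr0n _ 2))).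
    by exists k.
  have /choice[f fP] (i : 'I_d.+1) : exists q,
      ratr q \in `]cons_cV p i ord0 - r k, cons_cV p i ord0 + r k[.
    by apply: rat_in_itvoo; rewrite ltrBlDr -addrA ltrDl addr_gt0.
  have cf i : `| ratr (f i) - cons_cV p i ord0 | < r k.
    by move: (fP i); rewrite in_itv/= ltr_distl.
  have pf : ball (c (\col_i f i)) (r k) (cons_cV p).
    by split=> // i j; rewrite ord1 /c [map_mx _ _ _ _]mxE [X in ratr X]mxE; exact: cf.
  exists (\col_i f i, k) => //; rewrite /F.
  case: asboolP => [_|]; first exact/(FE _ (_, _)).
  case=> w /= qw; apply: eU; split => // i j.
  rewrite (splitr e); apply: (@ball_triangle _ _ (c (\col_i f i) i j)).
    apply: le_ball (ltW ke) _ _; apply: ball_sym; exact: (pf.2 i j).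
  by apply: le_ball (ltW ke) _ _; exact: (qw.2 i j).
apply: countable_bigcupT_measurable => // q; rewrite /F.
case: asboolP => // _; apply: measurableX; first exact: measurable_ball.
by apply: sub_sigma_algebra; exact: ball_open.
Qed.

Section lebesgue_cons.
Variables (d : nat) (m : {sigma_finite_measure set 'cV[R]_d -> \bar R}).

Definition lebesgue_cons : set 'cV[R]_d.+1 -> \bar R :=
  pushforward (@lebesgue_measure R \x m)%E (@cons_cV d).

Let lebesgue_cons0 : lebesgue_cons set0 = 0%E.
Proof. by rewrite /lebesgue_cons /pushforward preimage_set0 measure0. Qed.

Let lebesgue_cons_ge0 A : (0 <= lebesgue_cons A)%E.
Proof. by rewrite /lebesgue_cons /pushforward measure_ge0. Qed.

Let lebesgue_cons_sigma_additive : semi_sigma_additive lebesgue_cons.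
Proof.
move=> F mF tF mUF; rewrite /lebesgue_cons /pushforward preimage_bigcup.
apply: measure_semi_sigma_additive.
- by move=> n; rewrite -[X in measurable X]setTI; exact: measurable_cons_cV.
- apply/trivIsetP => /= i j _ _ ij; rewrite -preimage_setI.
  by move/trivIsetP : tF => /(_ _ _ _ _ ij) ->//; rewrite preimage_set0.
- rewrite -preimage_bigcup -[X in measurable X]setTI.
  exact: measurable_cons_cV.
Qed.

HB.instance Definition _ := isMeasure.Build _ _ _ lebesgue_cons
  lebesgue_cons0 lebesgue_cons_ge0 lebesgue_cons_sigma_additive.

Let lebesgue_cons_sigma_finite : sigma_finite setT lebesgue_cons.
Proof.
have [F FT Foo] : sigma_finite setT (@lebesgue_measure R \x m)%E.
  have /sigma_finiteP[F [TF ndF Foo]] := sigma_finiteT (@lebesgue_measure R).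
  have /sigma_finiteP[G [TG ndG Goo]] := sigma_finiteT m.
  exists (fun n => F n `*` G n).
    rewrite -setXTT TF TG predeqE => -[x y]; split.
      move=> [/= [n _ Fnx] [k _ Gky]]; exists (maxn n k) => //; split.
      - by move: x Fnx; exact/subsetPset/ndF/leq_maxl.
      - by move: y Gky; exact/subsetPset/ndG/leq_maxr.
    by move=> [n _ []/= ? ?]; split; exists n.
  move=> k; have [? ?] := Foo k; have [? ?] := Goo k.
  split; first exact: measurableX.
  by rewrite product_measure1E// lte_mul_pinfty// ge0_fin_numE.
exists (fun k => @uncons_cV d @^-1` F k).
  by rewrite -preimage_bigcup -FT preimage_setT.
move=> k; have [mF Fk] := Foo k; split.
  by rewrite -[X in measurable X]setTI; exact: measurable_uncons_cV.
rewrite /lebesgue_cons /pushforward -comp_preimage.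
suff -> : @uncons_cV d \o @cons_cV d = id by [].
by apply/funext => p /=; rewrite cons_cVK.
Qed.

HB.instance Definition _ := Measure_isSigmaFinite.Build _ _ _ lebesgue_cons
  lebesgue_cons_sigma_finite.

End lebesgue_cons.

(* d-dimensional Lebesgue measure, by R^(d+1) = R x R^d; a unit mass if d = 0. *)
Fixpoint lebesgue_cV (d : nat) : {sigma_finite_measure set 'cV[R]_d -> \bar R} :=
  if d is d'.+1 then lebesgue_cons (lebesgue_cV d') else dirac (0 : 'cV[R]_0).

End lebesgue_measure_cV.

Section glm.
Variable R : realType.

Definition Gamma (s : R) : R :=
  \int[lebesgue_measure]_(t in `]0, +oo[) (t `^ (s - 1) * expR (- t)).

Definition negative_binomial_pmf (xi p : R) (y : nat) : R :=
  Gamma (y%:R + xi) / (y`!%:R * Gamma xi) * p ^+ y * (1 - p) `^ xi.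

Definition standard_normal_cdf (x : R) : R := fine (normal_prob 0 1 `]-oo, x]).

Inductive glm : Type :=
| Poisson
| NegativeBinomial of {posnum R}
| Logistic
| Probit.

Definition response (g : glm) : Type :=
  match g with
  | Poisson | NegativeBinomial _ => nat
  | Logistic | Probit => bool
  end.

(* The mass function of a response whose linear predictor is [eta].  In the
   logistic model the success probability is (1 + exp eta)^-1, with this sign. *)
Definition glm_pmf (g : glm) (eta : R) : response g -> R :=
  match g return response g -> R with
  | Poisson => poisson_pmf (expR eta)
  | NegativeBinomial xi => negative_binomial_pmf xi%:num (1 + expR (- eta))^-1
  | Logistic => bernoulli_pmf (1 + expR eta)^-1
  | Probit => bernoulli_pmf (standard_normal_cdf eta)
  end.

Definition dotv (d : nat) (u v : 'cV[R]_d) : R := (u^T *m v) ord0 ord0.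

Definition likelihood (g : glm) (n d : nat) (X : 'I_n -> 'cV[R]_d)
    (Y : 'I_n -> response g) (beta : 'cV[R]_d) : R :=
  \prod_(i < n) glm_pmf (dotv beta (X i)) (Y i).

Definition nll (g : glm) (n d : nat) (X : 'I_n -> 'cV[R]_d)
    (Y : 'I_n -> response g) (beta : 'cV[R]_d) : R :=
  - ln (likelihood X Y beta).

Definition pos_def (d : nat) (C : 'M[R]_d) : Prop :=
  forall v : 'cV[R]_d, v != 0 -> 0 < dotv v (C *m v).

Section posterior.
Variables (g : glm) (n d : nat) (X : 'I_n -> 'cV[R]_d) (Y : 'I_n -> response g).
Variables (alpha : R) (C : 'M[R]_d).

Definition posterior_kernel (beta : 'cV[R]_d) : R :=
  expR (- nll X Y beta - alpha / 2 * dotv beta (invmx C *m beta)).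

Definition posterior_Z : R := \int[lebesgue_cV R d]_beta posterior_kernel beta.

Definition posterior_pdf (beta : 'cV[R]_d) : R :=
  posterior_Z^-1 * posterior_kernel beta.

End posterior.

Definition mvnormal_pdf (d : nat) (m : 'cV[R]_d) (S : 'M[R]_d) (x : 'cV[R]_d) : R :=
  ((2 * pi) `^ (d%:R / 2) * Num.sqrt (\det S))^-1 *
  expR (- (dotv (x - m) (invmx S *m (x - m)) / 2)).

Local Open Scope ereal_scope.

(* Distributions and kernels are set functions: the integral of the library is
   defined with respect to any such function, not only for bundled measures. *)
Definition distribution_of (d : nat) (f : 'cV[R]_d -> R) (B : set 'cV[R]_d) : \bar R :=
  \int[lebesgue_cV R d]_(x in B) (f x)%:E.

Definition mhi_acceptance (d : nat) (p q : 'cV[R]_d -> R) (x y : 'cV[R]_d) : R :=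
  Num.min (p y * q x / (p x * q y))%R 1%R.

Definition mhi_kernel (d : nat) (p q : 'cV[R]_d -> R) (x : 'cV[R]_d)
    (B : set 'cV[R]_d) : \bar R :=
  \int[lebesgue_cV R d]_(y in B) (mhi_acceptance p q x y * q y)%:E +
  \d_x B * (1 - \int[lebesgue_cV R d]_y (mhi_acceptance p q x y * q y)%:E).

Section wasserstein.
Context {disp : measure_display} {T : measurableType disp}.

Fixpoint kernel_iter (K : T -> set T -> \bar R) (t : nat) (x : T) (B : set T) : \bar R :=
  match t with
  | 0 => \d_x B
  | 1 => K x B
  | t'.+1 => \int[K x]_y kernel_iter K t' y B
  end.

Definition coupling (mu nu : set T -> \bar R) : set (probability (T * T)%type R) :=
  [set xi | forall A : set T, measurable A ->
     xi (A `*` setT) = mu A /\ xi (setT `*` A) = nu A].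

Definition wasserstein (rho : T -> T -> R) (mu nu : set T -> \bar R) : \bar R :=
  ereal_inf [set \int[xi]_z (rho z.1 z.2)%:E | xi in coupling mu nu].

End wasserstein.

Record is_metric (T : Type) (rho : T -> T -> R) : Prop := IsMetric {
  metric_ge0 : forall x y, (0 <= rho x y)%R;
  metric_eq0 : forall x y, rho x y = 0%R <-> x = y;
  metric_sym : forall x y, rho x y = rho y x;
  metric_triangle : forall x y z, (rho x z <= rho x y + rho y z)%R
}.

Definition lsc_metric (d : nat) (rho : 'cV[R]_d -> 'cV[R]_d -> R) : Prop :=
  is_metric rho /\
  lower_semicontinuous (fun z : 'cV[R]_d * 'cV[R]_d => (rho z.1 z.2)%:E).

End glm.

Arguments Poisson {R}.
Arguments Logistic {R}.
Arguments Probit {R}.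

(* Main.v *)
Require Import Defs.
From HB Require Import structures.
From mathcomp Require Import all_boot all_order all_algebra.
From mathcomp Require Import all_classical all_reals all_analysis.
From mathcomp Require Import measurable_realfun.
From mathcomp Require Import ring lra.

(* Write p for the posterior density, q for the proposal density and b for the
   posterior mode.  Convexity of the negative log-likelihood l and optimality of
   b give l y >= l b - alpha <C^-1 (y - b), b>, which says exactly that q / p is
   minimal at b; its value there is eps.  Hence the chain started at b moves
   with law eps Pi + (1 - eps) delta_b, and invariance of Pi yields
   P^t(b, .) = (1 - s) Pi + s delta_b with s = (1 - eps)^t.
   The coupling that keeps the common part (1 - s) Pi on the diagonal costs
   s \int rho(., b) dPi, and the 1-Lipschitz functions min (rho(., b)) k show
   that no coupling is cheaper. *)

Import Order.TTheory GRing.Theory Num.Theory.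
Import numFieldNormedType.Exports HBNNSimple.

Set Implicit Arguments.
Unset Strict Implicit.
Unset Printing Implicit Defensive.

Local Open Scope classical_set_scope.
Local Open Scope ring_scope.

(** * Log-concave mass functions *)

(** The mode is a special starting point because the proposal carries the covariance of the prior:
    in ln (q / p) the quadratic terms cancel, and what is left is l plus an affine function, hence
    convex. Both p and q are largest at b, so b is a critical point of this convex function and
    therefore its minimum. Convexity of l is derived from the four mass functions, and gradients on
    R^d are avoided: the logarithm of each mass has supporting lines in the linear predictor, and
    optimality of b is used along segments only. Up to constants, the Poisson, negative-binomial and
    logistic masses are products of powers of exp, exp (- exp) and the logistic function, for which
    tangents of exp suffice; the probit mass rests on a Mills ratio bound. That the proposal density
    has mass one, which both the rejection probability and eps <= 1 depend on, is obtained by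
    eliminating one coordinate at a time from the Gaussian integral. *)

Section log_concave.
Variable R : realType.
Implicit Types f g : R -> R.

(* A supporting line for [ln f], stated multiplicatively so that [f = 0] is
   allowed: the negative-binomial coefficient need not be shown nonzero. *)
Definition log_concave f := (forall x, 0 <= f x) /\
  forall x, exists m, forall y, f y <= f x * expR (m * (y - x)).

Lemma log_concave_cst (c : R) : 0 <= c -> log_concave (cst c).
Proof.
by move=> c0; split=> // x; exists 0 => y /=; rewrite mul0r expR0 mulr1.
Qed.

Lemma log_concaveM f g : log_concave f -> log_concave g ->
  log_concave (fun x => f x * g x).
Proof.
move=> [f0 fs] [g0 gs]; split=> [x|x]; first exact: mulr_ge0.
have [[m fm] [n gn]] := (fs x, gs x).
exists (m + n) => y; rewrite mulrDl expRD mulrACA.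
exact: ler_pM.
Qed.

Lemma log_concaveX f k : log_concave f -> log_concave (fun x => f x ^+ k).
Proof.
move=> lf; elim: k => [|k ih].
  by have := log_concave_cst ler01; under eq_fun do rewrite expr0.
by under eq_fun do rewrite exprS; exact: log_concaveM.
Qed.

Lemma log_concave_powR f (a : R) : 0 <= a -> log_concave f ->
  log_concave (fun x => f x `^ a).
Proof.
move=> a0 [f0 fs]; split=> [x|x]; first exact: powR_ge0.
have [m fm] := fs x; exists (m * a) => y.
rewrite mulrAC expRM -powRM ?expR_ge0//.
by rewrite ge0_ler_powR ?nnegrE ?mulr_ge0 ?expR_ge0.
Qed.

Lemma log_concaveN f : log_concave f -> log_concave (fun x => f (- x)).
Proof.
move=> [f0 fs]; split=> // x; have [m fm] := fs (- x).
by exists (- m) => y; apply: le_trans (fm _) _; rewrite mulNr -mulrN opprB opprK addrC.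
Qed.

Lemma log_concave_expR : log_concave (@expR R).
Proof.
split=> [x|x]; first exact: expR_ge0.
by exists 1 => y; rewrite -expRD mul1r subrKC.
Qed.

Lemma expR_tangent (x y : R) : expR x * (1 + (y - x)) <= expR y.
Proof.
rewrite -[in leRHS](subrKC x y) expRD ler_pM2l ?expR_gt0//.
exact: expR_ge1Dx.
Qed.

Lemma log_concave_expRNexpR : log_concave (fun x : R => expR (- expR x)).
Proof.
split=> [x|x]; first exact: expR_ge0.
exists (- expR x) => y; rewrite -expRD ler_expR.
by have := expR_tangent x y; rewrite mulrDr mulr1 mulNr; lra.
Qed.

(** The slope at [x] is the logarithmic derivative [- p] with p = e^x / (1 + e^x). After inversion
    the claim becomes e^(p h) <= p e^h + (1 - p), which is Jensen's inequality for exp at the points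
    [h] and 0. *)
Lemma log_concave_logistic : log_concave (fun x : R => (1 + expR x)^-1).
Proof.
have D0 (x : R) : 0 < 1 + expR x by rewrite addr_gt0 ?expR_gt0.
split=> [x|x]; first by rewrite invr_ge0 ltW.
exists (- (expR x / (1 + expR x))) => y.
set p := expR x / _; set h := y - x.
rewrite mulNr expRN -invfM lef_pV2 ?posrE ?mulr_gt0 ?expR_gt0//.
have px : (1 + expR x) * p = expR x.
  by rewrite /p mulrC divfK// gt_eqF.
have -> : expR y = expR x * expR h by rewrite -expRD subrKC.
have p_ge0 : 0 <= p by rewrite divr_ge0 ?expR_ge0// ltW.
have p_le1 : 0 <= 1 - p by rewrite subr_ge0 ler_pdivrMr ?mul1r// lerDr.
have -> : 1 + expR x * expR h = (1 + expR x) * (p * expR h + (1 - p)).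
  by rewrite -[in LHS]px mulrDr mulrBr mulr1 px mulrA px; ring.
rewrite ler_pM2l//.
(* Tangents of [expR] at [p * h] give [1 - p + p * expR h >= expR (p * h)]. *)
have /(ler_wpM2l p_ge0) h1 := expR_tangent (p * h) h.
have /(ler_wpM2l p_le1) := expR_tangent (p * h) 0.
rewrite expR0 mulr1 => /(lerD h1); apply: le_trans.
by rewrite le_eqVlt; apply/orP; left; apply/eqP; ring.
Qed.

(** By the mean value theorem [ln f] has increment f'(z) / f(z) times the step, with [z] between the
    two points. Monotonicity of the logarithmic derivative replaces [z] by [x], with the right sign
    on either side of [x]. *)
Lemma log_concave_of_log_derive f f' : (forall x, 0 < f x) ->
  (forall x : R, is_derive x (1 : R) f (f' x)) ->
  (forall x y, x <= y -> f' y / f y <= f' x / f x) -> log_concave f.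
Proof.
move=> f0 df ndf; split=> [x|x]; first exact: ltW.
have dl (z : R) : is_derive z (1 : R) (fun x => ln (f x)) (f' z / f z).
  have dl := is_derive1_ln (f0 z).
  by rewrite mulrC; exact: is_derive1_comp.
exists (f' x / f x) => y.
rewrite -[f y]lnK ?posrE// -[X in X * _]lnK ?posrE// -expRD ler_expR -lerBlDl.
have cl a b : {within `[a, b], continuous (fun x => ln (f x))}.
  apply: continuous_subspaceT => z; apply: differentiable_continuous.
  by apply/derivable1_diffP; have [] := dl z.
have [xy|yx|->] := ltgtP x y; last by rewrite !subrr mulr0.
  have [z] := MVT xy (fun z _ => dl z) (cl _ _).
  rewrite in_itv/= => /andP[xz _] ->.
  by rewrite ler_pM2r ?subr_gt0// ndf// ltW.
have [z] := MVT yx (fun z _ => dl z) (cl _ _).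
rewrite in_itv/= => /andP[_ zx] E.
rewrite -lerN2 opprB E -mulrN opprB.
by rewrite ler_pM2r ?subr_gt0// ndf// ltW.
Qed.

End log_concave.

(** * Log-concavity of the standard normal distribution function *)

Section standard_normal.
Variable R : realType.
Local Notation mu := (@lebesgue_measure R).
Local Notation phi := (@normal_pdf R 0 1).
Local Notation Phi := (@standard_normal_cdf R).

Lemma std_normal_pdfE (x : R) : phi x = normal_peak 1 * expR (- (x ^+ 2 / 2)).
Proof. by rewrite normal_pdfE ?oner_neq0//= /normal_fun subr0 expr1n mulNr. Qed.

Lemma std_normal_pdf_gt0 (x : R) : 0 < phi x.
Proof.
by rewrite std_normal_pdfE mulr_gt0 ?expR_gt0 ?normal_peak_gt0 ?oner_neq0.
Qed.

Lemma std_normal_pdfN (x : R) : phi (- x) = phi x.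
Proof. by rewrite !std_normal_pdfE sqrrN. Qed.

Lemma is_derive_std_normal_pdf (x : R) : is_derive x (1 : R) phi (- x * phi x).
Proof.
have -> : phi = (fun x => normal_peak 1 * expR (- (x ^+ 2 / 2))).
  by apply/funext => y; rewrite std_normal_pdfE.
have d2 : is_derive x (1 : R) (fun y : R => - (y ^+ 2 / 2)) (- x).
  apply: is_derive_eq; rewrite /GRing.scale /=; lra.
have d3 := @is_derive1_comp R (@expR R) _ x _ _ (is_derive_expR _) d2.
by apply: is_derive_eq; rewrite /GRing.scale/= /GRing.scale/=; ring.
Qed.

Lemma is_derive_std_normal_cdf (x : R) : is_derive x (1 : R) Phi (phi x).
Proof.
(* The fundamental theorem of calculus differentiates strictly inside the domain of integrability,
   hence the endpoint [x + 1]. *)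
have int : mu.-integrable [set` Interval -oo%O (BRight (x + 1))] (EFin \o phi).
  by apply: integrableS (integrable_normal_pdf 0 1).
have xx1 : x < x + 1 by rewrite ltrDl.
have [|d e] := continuous_FTC1 xx1 int _
  (continuous_normal_pdf (oner_neq0 _) (x := x)).
  by rewrite ltNyr.
have -> : phi x = 'D_1 Phi x by rewrite -derive1E.
by apply: DeriveDef.
Qed.

Lemma std_normal_cdf_ge0 (x : R) : 0 <= Phi x.
Proof. by rewrite fine_ge0// measure_ge0. Qed.

Lemma continuous_std_normal_cdf : continuous Phi.
Proof.
move=> x; apply: differentiable_continuous; apply/derivable1_diffP.
by have [] := is_derive_std_normal_cdf x.
Qed.

Lemma std_normal_cdf_increasing (x y : R) : x < y -> Phi x < Phi y.
Proof.
move=> xy.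
have [|z _ E] := MVT xy (fun z _ => is_derive_std_normal_cdf z).
  exact/continuous_subspaceT/continuous_std_normal_cdf.
by rewrite -subr_gt0 E mulr_gt0 ?subr_gt0// std_normal_pdf_gt0.
Qed.

Lemma std_normal_cdf_gt0 (x : R) : 0 < Phi x.
Proof.
apply: le_lt_trans (std_normal_cdf_ge0 (x - 1)) _.
by apply: std_normal_cdf_increasing; rewrite ltrBlDr ltrDl.
Qed.

Lemma std_normal_cdf_integral (x : R) :
  (\int[mu]_(t in `[x, +oo[) (phi t)%:E = (Phi (- x))%:E)%E.
Proof.
rewrite /standard_normal_cdf fineK ?fin_num_measure//.
rewrite /normal_prob ge0_integration_by_substitutionNy.
- by apply: eq_integral => t _ /=; rewrite std_normal_pdfN.
- exact/continuous_subspaceT/continuous_normal_pdf/oner_neq0.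
- by move=> t _; exact: normal_pdf_ge0.
Qed.

(** Turns the failure probability of the probit model into a reflection, so that log-concavity is
    needed for [Phi] alone. *)
Lemma std_normal_cdfN (x : R) : Phi (- x) = 1 - Phi x.
Proof.
apply: EFin_inj; rewrite -std_normal_cdf_integral EFinB.
rewrite /standard_normal_cdf fineK ?fin_num_measure//.
have <- : normal_prob 0 1 `]x, +oo[ = (\int[mu]_(t in `[x, +oo[) (phi t)%:E)%E.
  rewrite /normal_prob integral_itv_obnd_cbnd//.
  apply: measurable_funTS; apply/measurable_EFinP; exact: measurable_normal_pdf.
by rewrite -probability_setC// setCitvl.
Qed.

(* For [x < 0], compare [phi t] with [t / |x| * phi t] on [|x|, +oo[. *)
Lemma mills_ratio (x : R) : 0 <= x * Phi x + phi x.
Proof.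
have [x0|x0] := leP 0 x.
  by rewrite addr_ge0 ?mulr_ge0 ?std_normal_cdf_ge0 ?normal_pdf_ge0.
rewrite -[x]opprK mulNr addrC subr_ge0 std_normal_pdfN.
set y := - x; have y0 : 0 < y by rewrite oppr_gt0.
rewrite -lee_fin EFinM -std_normal_cdf_integral.
rewrite -ge0_integralZl//=; last 3 first.
- apply/measurable_funTS/measurable_EFinP; exact: measurable_normal_pdf.
- by move=> t _; rewrite lee_fin normal_pdf_ge0.
- by rewrite lee_fin ltW.
have cphi : continuous phi by exact: continuous_normal_pdf (oner_neq0 _).
have ctphi : continuous (fun t : R => t * phi t).
  by move=> t; apply: (@continuousM R R idfun phi t); [exact: cvg_id|exact: cphi].
have dN (t : R) : is_derive t (1 : R) (- phi) (t * phi t).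
  have d := is_derive_std_normal_pdf t.
  by apply: is_derive_eq; rewrite mulNr opprK.
(* [- phi] is an antiderivative of [t * phi t] and vanishes at infinity; for t >= 2 the bound t <=
   t^2 / 2 squeezes [phi] under a multiple of exp (- t). *)
have <- : (\int[mu]_(t in `[y, +oo[) (t * phi t)%:E = (phi y)%:E)%E.
  rewrite (@ge0_continuous_FTC2y _ _ (- phi) y 0).
  - by rewrite sub0e -EFinN opprK.
  - by move=> t yt; rewrite mulr_ge0 ?normal_pdf_ge0// (le_trans (ltW y0)).
  - exact: continuous_subspaceT.
  - rewrite -[X in _ --> X]oppr0; apply: cvgN.
    apply: (@squeeze_cvgr _ _ _ _ (cst 0) (fun t => normal_peak 1 * expR (- t))).
    + near=> t; apply/andP; split; first exact: normal_pdf_ge0.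
      rewrite std_normal_pdfE.
      rewrite ler_wpM2l ?normal_peak_ge0// ler_expR lerN2.
      have t2 : 2 <= t by near: t; exact: nbhs_pinfty_ge.
      by rewrite ler_pdivlMr// expr2 ler_wpM2l// (le_trans _ t2).
    + exact: cvg_cst.
    + by rewrite -[X in _ --> X](mulr0 (normal_peak 1)); apply: cvgMr; exact: cvgr_expR.
  - by move=> t _; have [] := dN t.
  - by apply: cvg_at_right_filter; apply: continuousN; exact: cphi.
  - by move=> t _; rewrite derive1E; have [_ ->] := dN t.
apply: ge0_le_integral => //=.
- by move=> t _; rewrite lee_fin mulr_ge0 ?normal_pdf_ge0// ltW.
- apply/measurable_funTS/measurable_EFinP/measurable_funM => //.
  exact: measurable_normal_pdf.
- apply/measurable_funTS/measurable_EFinP; exact: continuous_measurable_fun.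
- move=> t; rewrite in_itv/= andbT => yt.
  by rewrite lee_fin ler_wpM2r ?normal_pdf_ge0.
Unshelve. all: by end_near. Qed.

(** The logarithmic derivative phi / Phi has derivative - phi (t Phi + phi) / Phi^2, whose sign is
    that of the Mills ratio bound. *)
Lemma log_concave_std_normal_cdf : log_concave Phi.
Proof.
apply: (@log_concave_of_log_derive _ _ phi); first exact: std_normal_cdf_gt0.
  exact: is_derive_std_normal_cdf.
pose r t := phi t / Phi t.
have dr (t : R) : is_derive t (1 : R) r
    (- (phi t * (t * Phi t + phi t)) / Phi t ^+ 2).
  have Pt0 : Phi t != 0 by rewrite gt_eqF// std_normal_cdf_gt0.
  have d1 := is_derive_std_normal_pdf t; have d2 := is_derive_std_normal_cdf t.
  have d3 := is_deriveV Pt0 d2.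
  apply: is_derive_eq; rewrite /GRing.scale/=.
  by field.
move=> x y; rewrite le_eqVlt => /predU1P[->//|xy].
have [|z _ E] := MVT xy (fun z _ => dr z).
  apply: continuous_subspaceT => z; apply: differentiable_continuous.
  by apply/derivable1_diffP; have [] := dr z.
rewrite -subr_le0 [leLHS]E mulr_le0_ge0 ?subr_ge0 ?(ltW xy)//.
rewrite mulr_le0_ge0 ?invr_ge0 ?sqr_ge0// oppr_le0 mulr_ge0 ?mills_ratio//.
exact: normal_pdf_ge0.
Qed.

End standard_normal.

(** * Mass functions of the four models as functions of the linear predictor *)

Section glm_pmf.
Variable R : realType.

Lemma Gamma_ge0 (s : R) : 0 <= Gamma s.
Proof.
rewrite fine_ge0// integral_ge0// => t _.
by rewrite lee_fin mulr_ge0 ?powR_ge0 ?expR_ge0.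
Qed.

(** Serves twice: for failures in the logistic model, and for the factor (1 - p)^xi of the
    negative-binomial mass, which thereby becomes a power of the logistic function. *)
Lemma onem_logistic (eta : R) :
  1 - (1 + expR eta)^-1 = (1 + expR (- eta))^-1.
Proof.
have e0 := expR_gt0 eta.
rewrite expRN; field; rewrite !gt_eqF//= addr_gt0//.
Qed.

Lemma poisson_pmf_expR (eta : R) k :
  poisson_pmf (expR eta) k = expR eta ^+ k * k`!%:R^-1 * expR (- expR eta).
Proof. by rewrite /poisson_pmf expR_gt0. Qed.

Lemma log_concave_glm_pmf (g : glm R) (y : response g) :
  log_concave (fun eta => glm_pmf eta y).
Proof.
case: g y => [k|xi k|b|b] /=.
- under eq_fun do rewrite poisson_pmf_expR.
  apply: log_concaveM (log_concave_expRNexpR R).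
  apply: log_concaveM; first exact/log_concaveX/log_concave_expR.
  by apply: log_concave_cst; rewrite invr_ge0.
- have -> : (fun eta : R => negative_binomial_pmf xi%:num (1 + expR (- eta))^-1 k) =
    fun eta => Gamma (k%:R + xi%:num) / (k`!%:R * Gamma xi%:num) *
      (1 + expR (- eta))^-1 ^+ k * (1 + expR eta)^-1 `^ xi%:num.
    by apply/funext => eta; rewrite /negative_binomial_pmf onem_logistic opprK.
  apply: log_concaveM.
    apply: log_concaveM.
      by apply: log_concave_cst; rewrite divr_ge0 ?mulr_ge0 ?Gamma_ge0.
    exact/log_concaveX/(log_concaveN (log_concave_logistic R)).
  by apply: log_concave_powR => //; exact: log_concave_logistic.
- case: b => /=; first exact: log_concave_logistic.
  under eq_fun do rewrite /bernoulli_pmf onem_logistic.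
  exact: (log_concaveN (log_concave_logistic R)).
- case: b => /=; first exact: log_concave_std_normal_cdf.
  under eq_fun do rewrite /bernoulli_pmf -std_normal_cdfN.
  exact: (log_concaveN (log_concave_std_normal_cdf R)).
Qed.

Lemma measurable_logistic : measurable_fun setT (fun eta : R => (1 + expR eta)^-1).
Proof.
apply: continuous_measurable_fun => x; apply: cvgV.
  by rewrite gt_eqF// addr_gt0 ?expR_gt0.
by apply: cvgD; [exact: cvg_cst|exact: continuous_expR].
Qed.

Lemma measurable_glm_pmf (g : glm R) (y : response g) :
  measurable_fun setT (fun eta => glm_pmf eta y).
Proof.
have mNlogistic : measurable_fun setT (fun eta : R => (1 + expR (- eta))^-1).
  exact: (measurableT_comp measurable_logistic).
case: g y => [k|xi k|b|b] /=.
- under eq_fun do rewrite poisson_pmf_expR.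
  have me : measurable_fun setT (@expR R) by [].
  apply: measurable_funM.
    by apply: measurable_funM => //; exact: measurable_funX.
  exact: (measurableT_comp me (measurableT_comp (@oppr_measurable R setT) me)).
- rewrite /negative_binomial_pmf; apply: measurable_funM.
    by apply: measurable_funM => //; exact: measurable_funX.
  pose q (eta : R) := 1 - (1 + expR (- eta))^-1.
  have mq : measurable_fun setT q by exact: measurable_funB.
  exact: (measurableT_comp (measurable_powR xi%:num) mq).
- case: b => /=; first exact: measurable_logistic.
  by apply: measurable_funB => //; exact: measurable_logistic.
- have mPhi := continuous_measurable_fun (@continuous_std_normal_cdf R).
  by case: b => //=; exact: measurable_funB.
Qed.

End glm_pmf.

Section dotv.
Variables (R : realType) (d : nat).
Implicit Types u v w : 'cV[R]_d.

Lemma dotvE u v : dotv u v = \sum_i u i ord0 * v i ord0.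
Proof. by rewrite /dotv mxE; apply: eq_bigr => i _; rewrite mxE. Qed.

Lemma dotvC u v : dotv u v = dotv v u.
Proof. by rewrite !dotvE; apply: eq_bigr => i _; rewrite mulrC. Qed.

Lemma dotvDl u v w : dotv (u + v) w = dotv u w + dotv v w.
Proof. by rewrite /dotv linearD mulmxDl mxE. Qed.

Lemma dotvZl a u w : dotv (a *: u) w = a * dotv u w.
Proof. by rewrite /dotv linearZ/= -scalemxAl mxE. Qed.

Lemma dotvNl u w : dotv (- u) w = - dotv u w.
Proof. by rewrite -scaleN1r dotvZl mulN1r. Qed.

Lemma dotvBl u v w : dotv (u - v) w = dotv u w - dotv v w.
Proof. by rewrite dotvDl dotvNl. Qed.

Lemma dotvDr u v w : dotv u (v + w) = dotv u v + dotv u w.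
Proof. by rewrite dotvC dotvDl !(dotvC u). Qed.

Lemma dotvZr a u w : dotv u (a *: w) = a * dotv u w.
Proof. by rewrite dotvC dotvZl dotvC. Qed.

Lemma dotvNr u w : dotv u (- w) = - dotv u w.
Proof. by rewrite dotvC dotvNl dotvC. Qed.

Lemma dotvBr u v w : dotv u (v - w) = dotv u v - dotv u w.
Proof. by rewrite dotvDr dotvNr. Qed.

Lemma dotv_sym (A : 'M[R]_d) u v : A^T = A -> dotv u (A *m v) = dotv v (A *m u).
Proof.
move=> As; rewrite /dotv -[in RHS]As -[RHS]trace_mx11 -mxtrace_tr.
by rewrite !trmx_mul !trmxK mulmxA trace_mx11.
Qed.

Lemma measurable_coord (i : 'I_d) : measurable_fun setT (fun v : 'cV[R]_d => v i ord0).
Proof.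
apply: (measurability _ (RGenOpens.measurableE R)).
move=> _ [_ [a [b ->]] <-]; rewrite setTI; apply: sub_sigma_algebra.
have /continuousP := @coord_continuous R d 1 i ord0.
by apply; exact: interval_open.
Qed.

Lemma measurable_dotv (w : 'cV[R]_d) : measurable_fun setT (fun v : 'cV[R]_d => dotv v w).
Proof.
under eq_fun do rewrite dotvE.
apply: measurable_sum => i; apply: measurable_funM => //.
exact: measurable_coord.
Qed.

Lemma measurable_quadratic (A : 'M[R]_d) :
  measurable_fun setT (fun v : 'cV[R]_d => dotv v (A *m v)).
Proof.
under eq_fun do rewrite dotvE.
apply: measurable_sum => i; apply: measurable_funM.
  exact: measurable_coord.
under eq_fun do rewrite mxE.
apply: measurable_sum => j; apply: measurable_funM => //.
exact: measurable_coord.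
Qed.

End dotv.

(** * Convexity of the negative log-likelihood *)

Section likelihood.
Variables (R : realType) (g : glm R) (n d : nat).
Variables (X : 'I_n -> 'cV[R]_d) (Y : 'I_n -> response g).
Local Notation L := (likelihood X Y).
Local Notation nll := (nll X Y).

Lemma likelihood_ge0 b : 0 <= L b.
Proof.
by apply: prodr_ge0 => i _; have [+ _] := log_concave_glm_pmf (Y i); apply.
Qed.

(** The supporting lines of the factors multiply, and their slopes [m i] combine into the vector sum
    of the [m i *: X i], which stands in for the gradient of the log-likelihood. *)
Lemma likelihood_supergradient b :
  exists v, forall b', L b' <= L b * expR (dotv (b' - b) v).
Proof.
have /choice[m mP] i : exists m, forall b',
    glm_pmf (dotv b' (X i)) (Y i) <=
    glm_pmf (dotv b (X i)) (Y i) * expR (m * (dotv (b' - b) (X i))).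
  have [_ /(_ (dotv b (X i)))[m mP]] := log_concave_glm_pmf (Y i).
  by exists m => b'; rewrite dotvBl.
exists (\sum_i m i *: X i) => b'.
have -> : dotv (b' - b) (\sum_i m i *: X i) =
    \sum_i m i * dotv (b' - b) (X i).
  rewrite /dotv mulmx_sumr summxE; apply: eq_bigr => i _.
  by rewrite -scalemxAr mxE.
rewrite expR_sum -big_split/=; apply: ler_prod => i _; rewrite mP andbT.
by have [+ _] := log_concave_glm_pmf (Y i); apply.
Qed.

(** Average the supporting inequality at the intermediate point [z] over the two endpoints: the
    linear terms cancel, because [z] is their barycenter. *)
Lemma nll_convex b b' (t : R) : 0 <= t -> t <= 1 ->
  nll (b + t *: (b' - b)) <= (1 - t) * nll b + t * nll b'.
Proof.
move=> t0 t1; set z := b + _; rewrite /Defs.nll.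
have [v Lv] := likelihood_supergradient z.
(* A zero of the likelihood at one point spreads to all points through the supporting inequality;
   then [ln 0 = 0] makes [nll] identically 0. The same argument, read backwards, makes [L] positive
   everywhere once [L z] is. *)
have [Lz|Lz] := eqVneq (L z) 0.
  have L0 x : L x = 0.
    by apply/le_anti; rewrite likelihood_ge0 andbT (le_trans (Lv x))// Lz mul0r.
  by rewrite !L0 ln0// oppr0 !mulr0 addr0.
have Lz0 : 0 < L z by rewrite lt_def Lz likelihood_ge0.
have Lgt0 x : 0 < L x.
  rewrite lt_def likelihood_ge0 andbT; apply/negP => /eqP Lx.
  have [w /(_ z)] := likelihood_supergradient x.
  by rewrite Lx mul0r leNgt Lz0.
have lnL x : ln (L x) <= ln (L z) + dotv (x - z) v.
  rewrite -[X in _ + X]expRK -lnM ?posrE ?expR_gt0// ler_ln ?posrE//.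
  by rewrite mulr_gt0 ?expR_gt0.
have t1' : 0 <= 1 - t by rewrite subr_ge0.
have := lerD (ler_wpM2l t1' (lnL b)) (ler_wpM2l t0 (lnL b')).
have -> : b - z = - t *: (b' - b) by rewrite opprD addrA subrr sub0r scaleNr.
have -> : b' - z = (1 - t) *: (b' - b) by rewrite opprD addrA scalerBl scale1r.
rewrite !dotvZl.
move: (ln (L b)) (ln (L b')) (ln (L z)) (dotv _ v) => B B' Z D h.
have E : (1 - t) * (Z + - t * D) + t * (Z + (1 - t) * D) = Z by ring.
by rewrite E in h; rewrite !mulrN -opprD lerN2.
Qed.

Lemma measurable_nll : measurable_fun setT nll.
Proof.
apply: measurableT_comp => //; apply: (measurableT_comp (@measurable_ln R)).
apply: measurable_prod => i _.
exact: (measurableT_comp (measurable_glm_pmf (Y i)) (measurable_dotv (X i))).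
Qed.

End likelihood.

(** * Gaussian integrals over column vectors *)

Section lebesgue_cV_integral.
Variables (R : realType) (d : nat).

Lemma uncons_cVK : cancel (@uncons_cV R d) (@cons_cV R d).
Proof.
move=> v; apply/colP => i; case: (unliftP ord0 i) => [j ->|->].
  by rewrite cons_cV_lift mxE.
by rewrite cons_cV0.
Qed.

Lemma cons_cVB (p q : R * 'cV[R]_d) : cons_cV p - cons_cV q = cons_cV (p - q).
Proof.
apply/colP => i; rewrite mxE [X in _ + X]mxE.
case: (unliftP ord0 i) => [j ->|->]; last by rewrite !cons_cV0.
by rewrite !cons_cV_lift !mxE.
Qed.

(** Tonelli for the pushforward that defines the measure. The added coordinate is integrated
    innermost, since it is the one in which the square gets completed. *)
Lemma ge0_integral_lebesgue_cV (f : 'cV[R]_d.+1 -> \bar R) :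
  measurable_fun setT f -> (forall x, 0 <= f x)%E ->
  (\int[lebesgue_cV R d.+1]_x f x =
   \int[lebesgue_cV R d]_y \int[@lebesgue_measure R]_s f (cons_cV (s, y)))%E.
Proof.
move=> mf f0.
have mc := @measurable_cons_cV R d.
rewrite [LHS](_ : _ = \int[pushforward (@lebesgue_measure R \x lebesgue_cV R d)%E
   (@cons_cV R d)]_x f x)%E//.
rewrite ge0_integral_pushforward//= preimage_setT.
rewrite fubini_tonelli2//; first exact: measurableT_comp.
Qed.

End lebesgue_cV_integral.

Section gaussian.
Variable R : realType.

Lemma integral_expRN_sqr (a c : R) : 0 < a ->
  (\int[@lebesgue_measure R]_x (expR (- (a * (x - c) ^+ 2 / 2)))%:E =
   (Num.sqrt (2 * pi / a))%:E)%E.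
Proof.
move=> a0; pose s := Num.sqrt a^-1.
have s0 : s != 0 by rewrite gt_eqF// sqrtr_gt0 invr_gt0.
have s2 : s ^+ 2 = a^-1 by rewrite sqr_sqrtr// invr_ge0 ltW.
have pk : normal_peak s = (Num.sqrt (2 * pi / a))^-1.
  by rewrite /normal_peak s2 -mulr_natl; congr (Num.sqrt _)^-1; ring.
have pa : 0 < Num.sqrt (2 * pi / a).
  by rewrite sqrtr_gt0 divr_gt0// mulr_gt0// pi_gt0.
rewrite -[RHS]mule1 -(integral_normal_pdf c s) -ge0_integralZl//=; last 2 first.
- by apply/measurable_EFinP; exact: measurable_normal_pdf.
- by move=> x _; rewrite lee_fin normal_pdf_ge0.
apply: eq_integral => x _; rewrite normal_pdfE//= -EFinM; congr EFin.
rewrite pk [RHS]mulrA divff ?mul1r ?gt_eqF// /normal_fun s2; congr expR.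
by rewrite -mulr_natr; field; rewrite gt_eqF.
Qed.

Lemma dotv_col_mx d (s t : R) (v w : 'cV[R]_d) :
  dotv (col_mx s%:M v : 'cV[R]_d.+1) (col_mx t%:M w) = s * t + dotv v w.
Proof.
rewrite /dotv (@tr_col_mx _ 1 d 1) (@mul_row_col _ 1 1 d 1) mxE; congr (_ + _).
by rewrite tr_scalar_mx mul_scalar_mx !mxE eqxx.
Qed.

(** The remaining matrix is the Schur complement of the corner entry [a]. *)
Lemma quadratic_complete_square d (a : R) (b : 'cV[R]_d) (D : 'M[R]_d)
    (s : R) (v : 'cV[R]_d) : a != 0 ->
  dotv (cons_cV (s, v)) (block_mx a%:M b^T b D *m cons_cV (s, v)) =
  a * (s + dotv b v / a) ^+ 2 + dotv v ((D - a^-1 *: (b *m b^T)) *m v).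
Proof.
move=> a0.
have bv : b^T *m v = (dotv b v)%:M by rewrite [LHS]mx11_scalar.
rewrite /cons_cV/= (@mul_block_col _ 1 d 1 d) -scalar_mxM bv -raddfD/=.
rewrite dotv_col_mx mulmxBl dotvBr -scalemxAl dotvZr -mulmxA bv.
rewrite !mul_mx_scalar dotvDr !dotvZr (dotvC v b).
by field.
Qed.

(** One step of Gaussian elimination, the left factor being unipotent. *)
Lemma det_block_schur d (a : R) (b : 'cV[R]_d) (D : 'M[R]_d) : a != 0 ->
  \det (block_mx a%:M b^T b D) = a * \det (D - a^-1 *: (b *m b^T)).
Proof.
move=> a0.
have -> : block_mx a%:M b^T b D =
    block_mx 1%:M 0 (a^-1 *: b) 1%:M *m
    block_mx a%:M b^T 0 (D - a^-1 *: (b *m b^T)).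
  rewrite mulmx_block !mul1mx !mul0mx !addr0 -scalemxAl.
  by rewrite mul_mx_scalar scalerA mulVf// scale1r -scalemxAl addrC subrK.
by rewrite det_mulmx det_lblock !det1 !mul1r det_ublock det_scalar1.
Qed.

Lemma measurable_gaussian_fun d (A : 'M[R]_d) (m : 'cV[R]_d) :
  measurable_fun setT (fun x : 'cV[R]_d => expR (- (dotv (x - m) (A *m (x - m)) / 2))).
Proof.
apply: measurableT_comp => //; apply: measurableT_comp => //.
apply: measurable_funM => //.
rewrite (_ : (fun x : 'cV[R]_d => _) = (fun x : 'cV[R]_d => dotv x (A *m x) - dotv x (A *m m) -
   dotv x (A^T *m m) + dotv m (A *m m))).
  apply: measurable_funD => //; apply: measurable_funB => //.
    by apply: measurable_funB; [exact: measurable_quadratic|exact: measurable_dotv].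
  exact: measurable_dotv.
apply/funext => x; rewrite mulmxBr !(dotvBl, dotvBr).
have -> : dotv m (A *m x) = dotv x (A^T *m m).
  by rewrite /dotv -[LHS]trace_mx11 -mxtrace_tr !trmx_mul trmxK mulmxA trace_mx11.
by rewrite opprB addrA addrAC.
Qed.

(** Induction on the dimension through the Schur complement [S], which is again symmetric and
    positive definite. Positivity of the determinant comes along because det A = a det S; it later
    gives invertibility of [A]. *)
Lemma gaussian_integral_cV d (A : 'M[R]_d) (m : 'cV[R]_d) :
  A^T = A -> pos_def A -> 0 < \det A /\
  (\int[lebesgue_cV R d]_x (expR (- (dotv (x - m) (A *m (x - m)) / 2)))%:E =
   ((2 * pi) `^ (d%:R / 2) / Num.sqrt (\det A))%:E)%E.
Proof.
elim: d => [|d ih] in A m *.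
  move=> _ _; rewrite det_mx00; split => //.
  rewrite integral_dirac//; last first.
    by apply/measurable_EFinP; exact: measurable_gaussian_fun.
  rewrite diracT mul1e mul0r powRr0 sqrtr1 divr1.
  by rewrite dotvE big_ord0 mul0r oppr0 expR0.
move=> As Ap; pose a := A ord0 ord0.
pose b : 'cV[R]_d := @dlsubmx _ 1 d 1 d A; pose D : 'M[R]_d := @drsubmx _ 1 d 1 d A.
have AE : A = block_mx a%:M b^T b D :> 'M[R]_(1 + d).
  rewrite -[LHS](@submxK _ 1 d 1 d); congr block_mx.
    rewrite [LHS]mx11_scalar !mxE; congr (A _ _)%:M; exact/val_inj.
  by rewrite /b trmx_dlsub As.
have Ds : D^T = D by rewrite /D trmx_drsub As.
pose S := D - a^-1 *: (b *m b^T).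
have Ss : S^T = S by rewrite linearB linearZ/= trmx_mul trmxK Ds.
have a0 : 0 < a.
  have /Ap : delta_mx ord0 ord0 != 0 :> 'cV[R]_d.+1.
    by apply/eqP => /matrixP/(_ ord0 ord0)/eqP; rewrite !mxE !eqxx oner_eq0.
  by rewrite -colE /dotv trmx_delta -rowE !mxE.
have an0 : a != 0 by rewrite gt_eqF.
have Sp : pos_def S.
  (* The first coordinate is chosen to make the completed square vanish, so that the form of [A]
     there is the form of [S] at [v]. *)
  move=> v v0; have /Ap : cons_cV (- (dotv b v / a), v) != 0.
    apply: contra v0 => /eqP/colP e; apply/eqP/colP => i.
    by have := e (lift ord0 i); rewrite cons_cV_lift !mxE.
  by rewrite {1}AE quadratic_complete_square// addNr expr0n mulr0 add0r.
have detA : \det A = a * \det S by rewrite {1}AE det_block_schur.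
have [detS0 _] := ih S 0 Ss Sp.
split; first by rewrite detA mulr_gt0.
rewrite ge0_integral_lebesgue_cV; last 2 first.
- by apply/measurable_EFinP; exact: measurable_gaussian_fun.
- by move=> x; rewrite lee_fin expR_ge0.
pose n := (uncons_cV m).2; pose c := (uncons_cV m).1.
transitivity (\int[lebesgue_cV R d]_y ((Num.sqrt (2 * pi / a))%:E *
    (expR (- (dotv (y - n) (S *m (y - n)) / 2)))%:E))%E.
  apply: eq_integral => y _.
  (* In the first coordinate the integrand is a Gaussian whose center depends on [y] but whose mass
     does not. *)
  rewrite -(integral_expRN_sqr (c - dotv b (y - n) / a) a0).
  rewrite -ge0_integralZr//=; last first.
    apply/measurable_EFinP; apply: measurableT_comp => //.
    apply: measurableT_comp => //; apply: measurable_funM => //.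
    apply: measurable_funM => //; apply: measurable_funX.
    exact: measurable_funB.
  apply: eq_integral => s _; rewrite -EFinM -expRD; congr (expR _)%:E.
  rewrite -[m]uncons_cVK cons_cVB -[_ - uncons_cV m]/(s - c, y - n).
  by rewrite {1}AE quadratic_complete_square// -/S; field.
rewrite ge0_integralZl//=; last first.
  by apply/measurable_EFinP; exact: measurable_gaussian_fun.
have [_ ->] := ih S n Ss Sp.
rewrite -EFinM detA; congr EFin.
have pi2 : 0 <= 2 * pi :> R by rewrite mulr_ge0// pi_ge0.
rewrite sqrtrM// sqrtrV ?(ltW a0)// (sqrtrM (\det S) (ltW a0)) invfM.
rewrite -[Num.sqrt (2 * pi)]powR12_sqrt//.
have -> : (2 * pi) `^ (d.+1%:R / 2) = (2 * pi) `^ (2^-1) * (2 * pi) `^ (d%:R / 2) :> R.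
  rewrite -powRD; first by congr powR; rewrite -natr1; ring.
  by apply/implyP => _; rewrite gt_eqF// mulr_gt0// pi_gt0.
by ring.
Qed.

Lemma pos_def_unitmx d (A : 'M[R]_d) : A^T = A -> pos_def A -> A \in unitmx.
Proof.
move=> As Ap; have [detA _] := gaussian_integral_cV 0 As Ap.
by rewrite unitmxE unitfE gt_eqF.
Qed.

Lemma invmx_sym d (A : 'M[R]_d) : A^T = A -> (invmx A)^T = invmx A.
Proof. by move=> As; rewrite trmx_inv As. Qed.

Lemma pos_def_invmx d (A : 'M[R]_d) : A^T = A -> pos_def A -> pos_def (invmx A).
Proof.
move=> As Ap v v0; have Au := pos_def_unitmx As Ap.
have w0 : invmx A *m v != 0.
  apply: contra v0 => /eqP /(congr1 (mulmx A)).
  by rewrite mulKVmx// mulmx0 => ->.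
by have := Ap _ w0; rewrite mulKVmx// dotvC.
Qed.

Lemma pos_defZ d a (A : 'M[R]_d) : 0 < a -> pos_def A -> pos_def (a *: A).
Proof. by move=> a0 Ap v v0; rewrite -scalemxAl dotvZr mulr_gt0// Ap. Qed.

Lemma pos_def_det_gt0 d (A : 'M[R]_d) : A^T = A -> pos_def A -> 0 < \det A.
Proof. by move=> As Ap; have [] := gaussian_integral_cV 0 As Ap. Qed.

Lemma measurable_mvnormal_pdf d (m : 'cV[R]_d) (S : 'M[R]_d) :
  measurable_fun setT (mvnormal_pdf m S).
Proof. by apply: measurable_funM => //; exact: measurable_gaussian_fun. Qed.

Lemma mvnormal_norm_gt0 d (S : 'M[R]_d) : S^T = S -> pos_def S ->
  0 < (2 * pi) `^ (d%:R / 2) * Num.sqrt (\det S).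
Proof.
move=> Ss Sp; rewrite mulr_gt0 ?sqrtr_gt0 ?pos_def_det_gt0//.
by rewrite powR_gt0// mulr_gt0// pi_gt0.
Qed.

Lemma mvnormal_pdf_gt0 d (m : 'cV[R]_d) (S : 'M[R]_d) x : S^T = S -> pos_def S ->
  0 < mvnormal_pdf m S x.
Proof.
by move=> Ss Sp; rewrite mulr_gt0 ?expR_gt0// invr_gt0 mvnormal_norm_gt0.
Qed.

Lemma integral_mvnormal_pdf d (m : 'cV[R]_d) (S : 'M[R]_d) :
  S^T = S -> pos_def S ->
  (\int[lebesgue_cV R d]_x (mvnormal_pdf m S x)%:E = 1)%E.
Proof.
move=> Ss Sp; have Su := pos_def_unitmx Ss Sp.
have N0 := mvnormal_norm_gt0 Ss Sp.
rewrite /mvnormal_pdf; under eq_integral do rewrite EFinM.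
rewrite ge0_integralZl//=; last 2 first.
- by apply/measurable_EFinP; exact: measurable_gaussian_fun.
- by rewrite lee_fin invr_ge0 ltW.
have [_ ->] := gaussian_integral_cV m (invmx_sym Ss) (pos_def_invmx Ss Sp).
rewrite -EFinM det_inv sqrtrV ?(ltW (pos_def_det_gt0 Ss Sp))// invrK.
by rewrite mulVf// gt_eqF.
Qed.

End gaussian.

(** * Metropolis-Hastings independence kernels *)

(** Both sides agree on indicators by hypothesis, on simple functions by linearity, and in general
    by monotone convergence along the same approximating sequence. *)
Lemma ge0_integral_density d (T : measurableType d) (R : realType)
    (mu nu : {measure set T -> \bar R}) (f : T -> R) (g : T -> \bar R) :
  measurable_fun setT f -> (forall x, 0 <= f x) ->
  (forall A, measurable A -> nu A = \int[mu]_(x in A) (f x)%:E)%E ->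
  measurable_fun setT g -> (forall x, 0 <= g x)%E ->
  (\int[nu]_x g x = \int[mu]_x (g x * (f x)%:E))%E.
Proof.
move=> mf f0 nuE mg g0; pose g_ := nnsfun_approx measurableT mg.
have mEf : measurable_fun setT (EFin \o f) by apply/measurable_EFinP.
have g_g (x : T) : (g_ n x)%:E @[n --> \oo] --> g x by exact: cvg_nnsfun_approx.
transitivity (limn (fun n => \int[nu]_x (g_ n x)%:E))%E.
  rewrite -monotone_convergence//=.
  - by apply: eq_integral => x _; apply/esym/cvg_lim.
  - by move=> n; exact/measurable_EFinP.
  - by move=> n x _; rewrite lee_fin.
  - by move=> x _ a b ab; rewrite lee_fin; exact/lefP/nd_nnsfun_approx.
transitivity (limn (fun n => \int[mu]_x ((g_ n x)%:E * (f x)%:E)))%E; last first.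
  rewrite -monotone_convergence//=.
  - apply: eq_integral => x _; apply/cvg_lim => //.
    by apply: cvgeZr => //; exact: g_g.
  - by move=> n; apply: emeasurable_funM => //; exact/measurable_EFinP.
  - by move=> n x _; rewrite mule_ge0// lee_fin.
  - move=> x _ a b ab; rewrite lee_wpmul2r ?lee_fin//.
    exact/lefP/nd_nnsfun_approx.
congr (limn _); apply/funext => n.
rewrite integralT_nnsfun sintegralE.
transitivity (\int[mu]_x \sum_(r \in range (g_ n))
    ((r * \1_(g_ n @^-1` [set r]) x)%:E * (f x)%:E))%E; last first.
  apply: eq_integral => x _; rewrite [in RHS]fimfunE -fsumEFin// ge0_mule_fsuml// => r.
  by rewrite EFinM nnfun_muleindic_ge0.
rewrite ge0_integral_fsum//; last 2 first.
- move=> r; apply: emeasurable_funM => //.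
  by apply/measurable_EFinP/measurable_funM => //; exact: measurable_indic.
- by move=> r x _; rewrite mule_ge0 ?lee_fin// -lee_fin EFinM nnfun_muleindic_ge0.
apply: eq_fsbigr => r _.
under eq_integral do rewrite EFinM -muleA.
have [r0|r0] := leP 0 r; last first.
  rewrite preimage_nnfun0//= measure0 mule0; apply/esym/integral0_eq => x _.
  by rewrite indicE in_set0 mul0e mule0.
rewrite ge0_integralZl//; last 2 first.
- by apply: emeasurable_funM => //; apply/measurable_EFinP; exact: measurable_indic.
- by move=> x _; rewrite mule_ge0 ?lee_fin.
congr (_ * _)%E; rewrite nuE// [LHS]integral_mkcond; apply: eq_integral => x _.
by rewrite epatch_indic muleC.
Qed.

Section distribution_measure.
Variables (R : realType) (d : nat) (f : 'cV[R]_d -> R).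
Hypotheses (mf : measurable_fun setT f) (f0 : forall x, 0 <= f x).

Let distribution0 : distribution_of f set0 = 0%E.
Proof. by rewrite /distribution_of integral_set0. Qed.

Let distribution_ge0 A : (0 <= distribution_of f A)%E.
Proof. by apply: integral_ge0 => x _; rewrite lee_fin. Qed.

Let distribution_sigma_additive : semi_sigma_additive (distribution_of f).
Proof.
apply: semi_sigma_additive_nng_induced; first exact/measurable_EFinP.
by move=> x; rewrite lee_fin.
Qed.

HB.instance Definition _ := isMeasure.Build _ _ _ (distribution_of f)
  distribution0 distribution_ge0 distribution_sigma_additive.

Definition distribution_measure : {measure set 'cV[R]_d -> \bar R} :=
  distribution_of f.

Lemma integral_distribution_of (g : 'cV[R]_d -> \bar R) :
  measurable_fun setT g -> (forall x, 0 <= g x)%E ->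
  (\int[distribution_of f]_x g x = \int[lebesgue_cV R d]_x (g x * (f x)%:E))%E.
Proof. exact: (@ge0_integral_density _ _ _ (lebesgue_cV R d) distribution_measure). Qed.

End distribution_measure.

Section mhi.
Variables (R : realType) (d : nat) (p q : 'cV[R]_d -> R).
Hypotheses (p_gt0 : forall x, 0 < p x) (q_gt0 : forall x, 0 < q x).
Hypotheses (mp : measurable_fun setT p) (mq : measurable_fun setT q).
Local Notation mu := (lebesgue_cV R d).
Hypothesis p_int : (\int[mu]_x (p x)%:E = 1)%E.
Hypothesis q_int : (\int[mu]_x (q x)%:E = 1)%E.
Local Notation K := (mhi_kernel p q).
Local Notation a := (mhi_acceptance p q).
Implicit Type g : 'cV[R]_d -> \bar R.

Let m x y : R := a x y * q y.

(** Moving [q y] inside the minimum clears it from the denominator; the bound by [q y], the symmetry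
    and the value at the ratio minimizer are then immediate. *)
Let mE x y : m x y = Num.min (p y * q x / p x) (q y).
Proof.
rewrite /m /mhi_acceptance minr_pMl ?(ltW (q_gt0 y))// mul1r; congr Num.min.
by field; rewrite !gt_eqF.
Qed.

Let m_ge0 x y : 0 <= m x y.
Proof. by rewrite mE le_min !ltW// divr_gt0// mulr_gt0. Qed.

Let m_sym x y : p x * m x y = p y * m y x.
Proof.
rewrite !mE !minr_pMr ?(ltW (p_gt0 _))// [RHS]minC; congr Num.min.
  by field; rewrite gt_eqF.
by field; rewrite gt_eqF.
Qed.

Let measurable_m : measurable_fun setT (fun z => m z.1 z.2).
Proof.
have -> : (fun z => m z.1 z.2) =
    fun z => Num.min (p z.2 * q z.1 * (p z.1) `^ (-1)) (q z.2).
  by apply/funext => z; rewrite mE powR_inv1// ltW.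
apply: measurable_minr; last exact: measurableT_comp mq measurable_snd.
apply: measurable_funM; last first.
  exact: measurableT_comp (measurable_powR _) (measurableT_comp mp measurable_fst).
apply: measurable_funM.
  exact: measurableT_comp mp measurable_snd.
exact: measurableT_comp mq measurable_fst.
Qed.

Let measurable_m1 x : measurable_fun setT (m x).
Proof. exact: (measurableT_comp measurable_m (measurable_pair1 x)). Qed.

Definition rejection x : R := 1 - \int[mu]_y (a x y * q y).

Let acceptance_le1 x : (\int[mu]_y (m x y)%:E <= 1)%E.
Proof.
rewrite -q_int; apply: ge0_le_integral => //.
- by move=> y _; rewrite lee_fin.
- exact/measurable_EFinP.
- exact/measurable_EFinP.
- by move=> y _; rewrite lee_fin mE ge_min lexx orbT.
Qed.

Let acceptance_ge0 x : (0 <= \int[mu]_y (m x y)%:E)%E.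
Proof. by apply: integral_ge0 => y _; rewrite lee_fin. Qed.

Let acceptance_fin_num x : (\int[mu]_y (m x y)%:E)%E \is a fin_num.
Proof.
by rewrite ge0_fin_numE// (le_lt_trans (acceptance_le1 x))// ltry.
Qed.

Let rejectionE x : ((rejection x)%:E = 1 - \int[mu]_y (m x y)%:E)%E.
Proof.
by rewrite /rejection EFinB /Rintegral fineK//; exact: acceptance_fin_num.
Qed.

Lemma rejection_ge0 x : 0 <= rejection x.
Proof. by rewrite -lee_fin rejectionE sube_ge0 ?acceptance_le1// acceptance_fin_num orbT. Qed.

Definition mhi_measure x : {measure set 'cV[R]_d -> \bar R} :=
  measure_add (distribution_measure (measurable_m1 x) (m_ge0 x))
    (mscale (NngNum (rejection_ge0 x)) \d_x).

(** An equality of set functions on all sets, so that integrals against [K x] become integrals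
    against a bundled measure by rewriting. *)
Lemma mhi_kernelE x : K x = mhi_measure x.
Proof.
apply/funext => A; rewrite [RHS](measure_addE _ _ A).
by rewrite [LHS]/mhi_kernel muleC -rejectionE.
Qed.

Lemma integral_mhi_kernel x g :
  measurable_fun setT g -> (forall y, 0 <= g y)%E ->
  (\int[K x]_y g y =
   \int[mu]_y (g y * (a x y * q y)%:E) + (rejection x)%:E * g x)%E.
Proof.
move=> mg g0; rewrite mhi_kernelE.
rewrite ge0_integral_measure_add// ge0_integral_mscale//.
rewrite integral_dirac// diracT mul1e; congr (_ + _)%E.
exact: integral_distribution_of.
Qed.

Lemma measurable_integral_mhi_kernel g :
  measurable_fun setT g -> (forall y, 0 <= g y)%E ->
  measurable_fun setT (fun x => \int[K x]_y g y)%E.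
Proof.
move=> mg g0; under eq_fun do rewrite integral_mhi_kernel//.
have mm : measurable_fun setT (fun z => (m z.1 z.2)%:E) by exact/measurable_EFinP.
apply: emeasurable_funD.
  apply: (measurable_fun_fubini_tonelli_F
    (fun z : 'cV[R]_d * 'cV[R]_d => g z.2 * (m z.1 z.2)%:E)%E) => //.
  - by apply: emeasurable_funM => //; exact: measurableT_comp mg measurable_snd.
  - by move=> z; rewrite mule_ge0 ?lee_fin.
apply: emeasurable_funM => //; under eq_fun do rewrite rejectionE.
apply: emeasurable_funB => //.
apply: (measurable_fun_fubini_tonelli_F
  (fun z : 'cV[R]_d * 'cV[R]_d => (m z.1 z.2)%:E)) => //.
by move=> z; rewrite lee_fin.
Qed.

(* Detailed balance: [p x * (a x y * q y)] is symmetric in [x] and [y]. *)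
Lemma mhi_kernel_invariant g :
  measurable_fun setT g -> (forall y, 0 <= g y)%E ->
  (\int[mu]_x ((\int[K x]_y g y) * (p x)%:E) = \int[mu]_x (g x * (p x)%:E))%E.
Proof.
move=> mg g0; under eq_integral do rewrite integral_mhi_kernel//.
have mEp : measurable_fun setT (EFin \o p) by exact/measurable_EFinP.
have mm : measurable_fun setT (fun z => (m z.1 z.2)%:E) by exact/measurable_EFinP.
pose J (z : 'cV[R]_d * 'cV[R]_d) := ((p z.1)%:E * (m z.1 z.2)%:E)%E.
have mJ : measurable_fun setT J.
  by apply: emeasurable_funM => //; exact: measurableT_comp mEp measurable_fst.
have J0 z : (0 <= J z)%E by rewrite mule_ge0 ?lee_fin// ltW.
pose H z := (g z.2 * J z)%E.
have mH : measurable_fun setT H.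
  by apply: emeasurable_funM => //; exact: measurableT_comp mg measurable_snd.
have H0 z : (0 <= H z)%E by rewrite mule_ge0.
have macc : measurable_fun setT (fun x => \int[mu]_y (m x y)%:E)%E.
  apply: (measurable_fun_fubini_tonelli_F
    (fun z : 'cV[R]_d * 'cV[R]_d => (m z.1 z.2)%:E)) => //.
  by move=> z; rewrite lee_fin.
have mrej : measurable_fun setT (fun x => (rejection x)%:E).
  by under eq_fun do rewrite rejectionE; exact: emeasurable_funB.
have -> : (\int[mu]_x ((\int[mu]_y (g y * (m x y)%:E) + (rejection x)%:E * g x) *
    (p x)%:E) = \int[mu]_x (\int[mu]_y H (x, y)) +
    \int[mu]_x ((rejection x)%:E * g x * (p x)%:E))%E.
  rewrite -ge0_integralD//; last 4 first.
  - by move=> x _; apply: integral_ge0.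
  - exact: measurable_fun_fubini_tonelli_F.
  - by move=> x _; rewrite !mule_ge0 ?lee_fin ?rejection_ge0// ltW.
  - by do 2 apply: emeasurable_funM => //.
  apply: eq_integral => x _.
  rewrite ge0_muleDl//; last 2 first.
  - by apply: integral_ge0 => y _; rewrite mule_ge0// lee_fin.
  - by rewrite mule_ge0// lee_fin rejection_ge0.
  congr (_ + _)%E; rewrite -ge0_integralZr//; last 3 first.
  - by apply: emeasurable_funM => //; exact/measurable_EFinP.
  - by move=> y _; rewrite mule_ge0 ?lee_fin.
  - by rewrite lee_fin ltW.
  by apply: eq_integral => y _; rewrite /H /J/= -muleA [(_%:E * (p x)%:E)%E]muleC.
rewrite (fubini_tonelli H)// -ge0_integralD//; last 4 first.
- by move=> x _; apply: integral_ge0.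
- exact: measurable_fun_fubini_tonelli_G.
- by move=> x _; rewrite !mule_ge0 ?lee_fin ?rejection_ge0// ltW.
- by do 2 apply: emeasurable_funM => //.
apply: eq_integral => y _.
(* By symmetry the flow into [y] equals the flow out of it, so the acceptance probability at [y]
   appears and adds up to 1 with the rejection probability. *)
have -> : (\int[mu]_x H (x, y) = g y * (p y)%:E * \int[mu]_x (m y x)%:E)%E.
  rewrite -ge0_integralZl//; last 3 first.
  - exact/measurable_EFinP.
  - by move=> x _; rewrite lee_fin.
  - by rewrite mule_ge0// lee_fin ltW.
  by apply: eq_integral => x _; rewrite /H /J/= -EFinM m_sym EFinM muleA.
rewrite -[((rejection y)%:E * _ * _)%E]muleA [((rejection y)%:E * _)%E]muleC.
have rej0 : (0 <= 1 - \int[mu]_x (m y x)%:E)%E.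
  by rewrite -rejectionE lee_fin rejection_ge0.
rewrite rejectionE -(ge0_muleDr _ (acceptance_ge0 y) rej0).
by rewrite addeCA subee ?adde0 ?mule1//.
Qed.

(** [kernel_iter] treats exponent 1 as a separate case. This makes the recursion uniform from
    exponent 0 on, where it amounts to integrating the Dirac kernel against [K x]. *)
Lemma kernel_iterS t x B : measurable B ->
  (kernel_iter K t.+1 x B = \int[K x]_y kernel_iter K t y B)%E.
Proof.
case: t => [mB|//].
rewrite integral_mhi_kernel; last 2 first.
- exact: measurable_fun_dirac.
- by move=> y; exact: measure_ge0.
rewrite rejectionE muleC [LHS]/mhi_kernel; congr (_ + _)%E.
rewrite integral_mkcond; apply: eq_integral => y _.
by rewrite epatch_indic muleC.
Qed.

Lemma kernel_iter_ge0 t x B : measurable B -> (0 <= kernel_iter K t x B)%E.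
Proof.
elim: t x => [|t ih] x mB; first exact: measure_ge0.
rewrite kernel_iterS// mhi_kernelE.
by apply: integral_ge0 => y _; exact: ih.
Qed.

Lemma measurable_kernel_iter t B : measurable B ->
  measurable_fun setT (fun x => kernel_iter K t x B).
Proof.
elim: t => [|t ih] mB; first exact: measurable_fun_dirac.
under eq_fun do rewrite kernel_iterS//.
apply: measurable_integral_mhi_kernel; first exact: ih.
by move=> y; exact: kernel_iter_ge0.
Qed.

Lemma kernel_iter_invariant t B : measurable B ->
  (\int[mu]_x (kernel_iter K t x B * (p x)%:E) = distribution_of p B)%E.
Proof.
move=> mB; elim: t => [|t ih].
  rewrite /distribution_of [RHS]integral_mkcond; apply: eq_integral => x _.
  by rewrite epatch_indic muleC.
rewrite -ih; under eq_integral do rewrite kernel_iterS//.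
apply: mhi_kernel_invariant; first exact: measurable_kernel_iter.
by move=> y; exact: kernel_iter_ge0.
Qed.

Section ratio_minimizer.
Variables (x0 : 'cV[R]_d).
Let eps := q x0 / p x0.
Hypothesis eps_min : forall y, eps * p y <= q y.

Lemma ratio_min_ge0 : 0 <= eps.
Proof. by rewrite divr_ge0// ltW. Qed.

(** Integrate [eps_min]: both densities have mass one. *)
Lemma ratio_min_le1 : eps <= 1.
Proof.
rewrite -lee_fin -[leRHS]q_int -[leLHS]mule1 -p_int -ge0_integralZl//; last 3 first.
- exact/measurable_EFinP.
- by move=> x _; rewrite lee_fin ltW.
- by rewrite lee_fin ratio_min_ge0.
apply: ge0_le_integral => //.
- by move=> y _; rewrite mule_ge0 ?lee_fin ?ratio_min_ge0// ltW.
- by apply: emeasurable_funM => //; exact/measurable_EFinP.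
- exact/measurable_EFinP.
- by move=> y _; rewrite -EFinM lee_fin eps_min.
Qed.

Let m_x0 y : m x0 y = eps * p y.
Proof.
by rewrite mE -mulrA [p y * _]mulrC min_l.
Qed.

Let rejection_x0 : rejection x0 = 1 - eps.
Proof.
apply: EFin_inj; rewrite rejectionE EFinB; congr (_ - _)%E.
under eq_integral do rewrite m_x0 EFinM.
rewrite ge0_integralZl// ?p_int ?mule1//.
- exact/measurable_EFinP.
- by move=> x _; rewrite lee_fin ltW.
- by rewrite lee_fin ratio_min_ge0.
Qed.

(* At [x0] the accepted proposals have density [eps * p], so that one step draws
   from the target with probability [eps] and stays put otherwise. *)
Lemma kernel_iter_ratio_min t B : measurable B ->
  (kernel_iter K t x0 B = (1 - (1 - eps) ^+ t)%:E * distribution_of p B +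
    ((1 - eps) ^+ t)%:E * \d_x0 B)%E.
Proof.
move=> mB; elim: t => [|t ih].
  by rewrite expr0 subrr mul0e add0e mul1e.
rewrite kernel_iterS// integral_mhi_kernel; last 2 first.
- exact: measurable_kernel_iter.
- by move=> y; exact: kernel_iter_ge0.
rewrite rejection_x0 ih.
under eq_integral do rewrite -/(m x0 _) m_x0 EFinM muleCA.
rewrite ge0_integralZl//; last 3 first.
- apply: emeasurable_funM; first exact: measurable_kernel_iter.
  exact/measurable_EFinP.
- by move=> x _; rewrite mule_ge0 ?kernel_iter_ge0// lee_fin ltW.
- by rewrite lee_fin ratio_min_ge0.
(* An accepted first move lands with law proportional to the target, which the remaining [t] steps
   preserve. *)
rewrite kernel_iter_invariant//.
have e1 : 0 <= 1 - eps by rewrite subr_ge0 ratio_min_le1.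
have s0 : 0 <= (1 - eps) ^+ t by exact: exprn_ge0.
have s1 : 0 <= 1 - (1 - eps) ^+ t.
  by rewrite subr_ge0 exprn_ile1// lerBlDr lerDl ratio_min_ge0.
have D0 : (0 <= distribution_of p B)%E.
  by apply: integral_ge0 => x _; rewrite lee_fin ltW.
have d0 : (0 <= \d_x0 B :> \bar R)%E by exact: measure_ge0.
move: (distribution_of p B) (\d_x0 B) D0 d0 => D d' D0 d0.
rewrite ge0_muleDr ?mule_ge0 ?lee_fin// !muleA -!EFinM -exprS addeA.
rewrite -(@ge0_muleDl _ D) ?lee_fin ?ratio_min_ge0 ?mulr_ge0//.
have -> : 1 - (1 - eps) ^+ t.+1 = eps + (1 - eps) * (1 - (1 - eps) ^+ t).
  by rewrite exprS; ring.
by [].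
Qed.

End ratio_minimizer.

End mhi.

(** * Wasserstein distance to a mixture *)

Section measurable_lsc.
Variables (R : realType) (d : nat).

Lemma rat_cV_dense (v : 'cV[R]_d) (e : R) : 0 < e ->
  exists q : 'cV[rat]_d, ball (map_mx ratr q : 'cV[R]_d) e v.
Proof.
move=> e0.
have /choice[f fP] (i : 'I_d) : exists q, ratr q \in `]v i ord0 - e, v i ord0 + e[.
  by apply: rat_in_itvoo; rewrite ltrBlDr -addrA ltrDl addr_gt0.
exists (\col_i f i); split => // i j; rewrite ord1 [map_mx _ _ _ _]mxE [X in ratr X]mxE.
by move: (fP i); rewrite in_itv/= -ltr_distl.
Qed.

(** Measurability on pairs refers to the product sigma-algebra, so second countability has to enter:
    an open set is the countable union of the products of balls with rational centers and radii 1 /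
    (k + 1) that it contains. *)
Lemma open_cVX_measurable (U : set ('cV[R]_d * 'cV[R]_d)) : open U -> measurable U.
Proof.
move=> oU.
pose r (k : nat) : R := k.+1%:R^-1.
pose c (q : 'cV[rat]_d) : 'cV[R]_d := map_mx ratr q.
pose F (q : ('cV[rat]_d * 'cV[rat]_d) * nat) : set ('cV[R]_d * 'cV[R]_d) :=
  let B := ball (c q.1.1) (r q.2) `*` ball (c q.1.2) (r q.2) in
  if `[< B `<=` U >] then B else set0.
have r0 k : 0 < r k by rewrite invr_gt0.
have -> : U = \bigcup_q F q.
  apply/seteqP; split => [p Up|p [q _]]; last first.
    by rewrite /F; case: asboolP => // qU; exact: qU.
  have /nbhs_ballP[e e0 eU] := open_nbhs_nbhs (conj oU Up).
  have [k /= ke] : exists k, r k < e / 2.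
    have [k _ /(_ _ (leqnn k))] := near_infty_natSinv_lt (PosNum (divr_gt0 e0 (ltr0n _ 2))).
    by exists k.
  have [q1 pq1] := rat_cV_dense p.1 (r0 k).
  have [q2 pq2] := rat_cV_dense p.2 (r0 k).
  have rr : r k + r k <= e by rewrite (splitr e) ltW// ltrD.
  exists (q1, q2, k) => //; rewrite /F /=.
  case: asboolP => [//|]; case=> w /= [qw1 qw2]; apply: eU.
  by split; apply: (le_ball rr); [apply: ball_triangle (ball_sym pq1) qw1|
    apply: ball_triangle (ball_sym pq2) qw2].
apply: countable_bigcupT_measurable => // q; rewrite /F.
case: asboolP => // _; apply: measurableX; apply: sub_sigma_algebra; exact: ball_open.
Qed.

Lemma measurable_lsc_cVX (f : 'cV[R]_d * 'cV[R]_d -> R) :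
  lower_semicontinuous (EFin \o f) -> measurable_fun setT f.
Proof.
move=> /lower_semicontinuousP lf.
apply: (measurability _ (RGenOInfty.measurableE R)) => _ [_ [a ->] <-].
rewrite setTI; apply: open_cVX_measurable.
rewrite (_ : f @^-1` _ = [set x | a%:E < (EFin \o f) x]%E); first exact: lf.
by apply/seteqP; split => x /=; rewrite in_itv/= andbT lte_fin.
Qed.

End measurable_lsc.

Section image_measure.
Context {d1 d2 : measure_display} {T1 : measurableType d1} {T2 : measurableType d2}.
Context {R : realType} (f : T1 -> T2) (mf : measurable_fun setT f).
Variable m : {measure set T1 -> \bar R}.

(* The library's measure structure on [pushforward] takes the measurability
   of [f] as an argument that unification cannot recover. *)
Definition image_measure : {measure set T2 -> \bar R}.
Proof. by refine (pushforward m f); exact: mf. Defined.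

Lemma image_measureE A : image_measure A = m (f @^-1` A).
Proof. by []. Qed.

Lemma ge0_integral_image_measure (g : T2 -> \bar R) :
  measurable_fun setT g -> (forall y, 0 <= g y)%E ->
  (\int[image_measure]_y g y = \int[m]_x g (f x))%E.
Proof.
by move=> mg g0; rewrite [LHS]ge0_integral_pushforward// => y _; exact: g0.
Qed.

End image_measure.

Section wasserstein_mixture.
Context {disp : measure_display} {T : measurableType disp} {R : realType}.
Variables (Pi : probability T R) (rho : T -> T -> R) (x0 : T) (s : R).
Hypotheses (rho_metric : is_metric rho).
Hypothesis mrho : measurable_fun setT (fun z : T * T => rho z.1 z.2).
Hypotheses (s0 : 0 <= s) (s1 : s <= 1).
Variable mu : set T -> \bar R.
Hypothesis muE : forall B, measurable B ->
  mu B = ((1 - s)%:E * Pi B + s%:E * \d_x0 B)%E.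

Let s1' : 0 <= 1 - s. Proof. by rewrite subr_ge0. Qed.

Let diag (x : T) := (x, x).

Let mdiag : measurable_fun setT diag.
Proof. exact: measurable_fun_pair. Qed.

Let mpair0 : measurable_fun setT (pair x0 : T -> T * T).
Proof. exact: measurable_fun_pair. Qed.

Definition mixture_coupling : set (T * T) -> \bar R :=
  measure_add (mscale (NngNum s1') (image_measure mdiag Pi))
    (mscale (NngNum s0) (image_measure mpair0 Pi)).

Let mixture_couplingE A : mixture_coupling A =
  ((1 - s)%:E * Pi (diag @^-1` A) + s%:E * Pi (pair x0 @^-1` A))%E.
Proof. by rewrite [LHS]measure_addE. Qed.

HB.instance Definition _ := Measure.on mixture_coupling.

Let mixture_couplingT : mixture_coupling setT = 1%E.
Proof.
by rewrite mixture_couplingE !preimage_setT probability_setT !mule1 -EFinD subrK.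
Qed.

HB.instance Definition _ :=
  @Measure_isProbability.Build _ _ R mixture_coupling mixture_couplingT.

Lemma coupling_mixture : coupling mu Pi mixture_coupling.
Proof.
move=> A mA; split; rewrite [LHS]mixture_couplingE ?muE//.
  congr (_ * Pi _ + _ * _)%E.
    by apply/seteqP; split => x //= -[].
  rewrite diracE; have [x0A|x0A] := boolP (x0 \in A).
    rewrite (_ : _ @^-1` _ = setT) ?probability_setT//.
    by apply/seteqP; split => // x _; split => //=; rewrite inE in x0A.
  rewrite (_ : _ @^-1` _ = set0) ?measure0//.
  by apply/seteqP; split => // x [/= /mem_set]; rewrite (negbTE x0A).
rewrite (_ : diag @^-1` _ = A); last by apply/seteqP; split => x //= -[].
rewrite (_ : pair x0 @^-1` _ = A); last by apply/seteqP; split => x //= -[].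
by rewrite -ge0_muleDl ?lee_fin// -EFinD subrK mul1e.
Qed.

Let f x : R := rho x x0.

Let f0 x : 0 <= f x. Proof. exact: metric_ge0. Qed.

Let mf : measurable_fun setT f.
Proof. exact: (measurableT_comp mrho (measurable_pair2 x0)). Qed.

Let mErho : measurable_fun setT (fun z : T * T => (rho z.1 z.2)%:E).
Proof. exact/measurable_EFinP. Qed.

Let Erho0 (z : T * T) : (0 <= (rho z.1 z.2)%:E)%E.
Proof. by rewrite lee_fin; exact: metric_ge0. Qed.

Lemma mixture_coupling_cost :
  (\int[mixture_coupling]_z (rho z.1 z.2)%:E = s%:E * \int[Pi]_x (f x)%:E)%E.
Proof.
rewrite ge0_integral_measure_add// !ge0_integral_mscale//.
rewrite !ge0_integral_image_measure//.
rewrite integral0_eq ?mule0 ?add0e; last first.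
  by move=> x _; congr EFin; exact/(metric_eq0 rho_metric).
by congr (_ * _)%E; apply: eq_integral => x _; rewrite /f (Defs.metric_sym rho_metric).
Qed.

(* Truncations of [rho _ x0] are bounded and 1-Lipschitz for [rho], so that the
   dual lower bound involves finite integrals even if the right-hand side is
   infinite. *)
Lemma coupling_cost_lower_bound (xi : probability (T * T)%type R) :
  coupling mu Pi xi ->
  (s%:E * \int[Pi]_x (f x)%:E <= \int[xi]_z (rho z.1 z.2)%:E)%E.
Proof.
move=> cxi; set W := (\int[xi]_z _)%E.
pose h (k : nat) x := Num.min (f x) k%:R.
have h0 k x : 0 <= h k x by rewrite le_min f0 ler0n.
have mh k : measurable_fun setT (h k) by apply: measurable_minr.
have mEh k : measurable_fun setT (fun x => (h k x)%:E) by exact/measurable_EFinP.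
have Eh0 k x : (0 <= (h k x)%:E)%E by rewrite lee_fin.
have hk k : (s%:E * \int[Pi]_x (h k x)%:E <= W)%E.
  have hlip z : h k z.2 <= rho z.1 z.2 + h k z.1.
    have tri : f z.2 <= rho z.1 z.2 + f z.1.
      rewrite /f (Defs.metric_sym rho_metric z.1 z.2).
      exact: (Defs.metric_triangle rho_metric).
    have r0 : 0 <= rho z.1 z.2 by exact: metric_ge0.
    rewrite /h addr_minr le_min !ge_min tri /= orbC -lerBlDr subrr.
    by rewrite r0.
  have int2 : (\int[xi]_z (h k z.2)%:E = \int[Pi]_x (h k x)%:E)%E.
    rewrite -(ge0_integral_image_measure measurable_snd xi (mEh k))//.
    apply: eq_measure_integral => A mA _.
    rewrite [LHS]image_measureE; apply: etrans (cxi A mA).2; congr (xi _).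
    by apply/seteqP; split => x //= -[].
  have int1 : (\int[xi]_z (h k z.1)%:E = (1 - s)%:E * \int[Pi]_x (h k x)%:E)%E.
    rewrite -(ge0_integral_image_measure measurable_fst xi (mEh k))//.
    rewrite (@eq_measure_integral _ _ _ _
      (measure_add (mscale (NngNum s1') Pi) (mscale (NngNum s0) \d_x0))); last first.
      move=> A mA _; rewrite [RHS]measure_addE.
      rewrite [LHS]image_measureE; apply: etrans (muE mA).
      apply: etrans (cxi A mA).1; congr (xi _).
      by apply/seteqP; split => x //= -[].
    rewrite ge0_integral_measure_add// !ge0_integral_mscale//.
    rewrite integral_dirac// diracT mul1e.
    (* The truncated distance vanishes at [x0], so the Dirac part of [mu] contributes nothing. *)
    have -> : h k x0 = 0.
      by rewrite /h /f (metric_eq0 rho_metric x0 x0).2// min_l.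
    by rewrite mule0 adde0.
  have fin : (\int[Pi]_x (h k x)%:E)%E \is a fin_num.
    rewrite ge0_fin_numE; last by apply: integral_ge0 => x _; rewrite lee_fin.
    apply: (@le_lt_trans _ _ (\int[Pi]_x (k%:R : R)%:E)%E).
      apply: ge0_le_integral => //.
      by move=> x _; rewrite lee_fin ge_min lexx orbT.
    by rewrite integral_cst// [X in (_ * X)%E]probability_setT mule1 ltry.
  (* The Lipschitz inequality integrated against [xi]. The integral of [h k] is finite, at most [k],
     and can therefore be subtracted, which leaves the factor [s]. *)
  have : (\int[Pi]_x (h k x)%:E <= W + (1 - s)%:E * \int[Pi]_x (h k x)%:E)%E.
    rewrite -int1 -int2 /W -ge0_integralD//; last first.
      exact: measurableT_comp (mEh k) measurable_fst.
    apply: ge0_le_integral => //.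
    - exact: measurableT_comp (mEh k) measurable_snd.
    - apply: emeasurable_funD => //.
      exact: measurableT_comp (mEh k) measurable_fst.
    - by move=> z _; rewrite -EFinD lee_fin.
  have W0 : (0 <= W)%E by apply: integral_ge0 => z _; exact: Erho0.
  rewrite -(fineK fin) -!EFinM; case: W W0 => [w| |]// _; last by move=> _; exact: leey.
  by rewrite -EFinD !lee_fin mulrBl mul1r; lra.
have hf x : (h k x)%:E @[k --> \oo] --> (f x)%:E.
  apply: cvg_near_cst; near=> n; rewrite /h min_l//.
  by near: n; exact: nbhs_infty_ger.
have nd x : {homo (fun k => (h k x)%:E) : a b / (a <= b)%N >-> (a <= b)%E}.
  move=> a b ab; rewrite lee_fin /h le_min !ge_min lexx/=.
  by rewrite ler_nat ab orbT.
have -> : (\int[Pi]_x (f x)%:E = limn (fun k => \int[Pi]_x (h k x)%:E))%E.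
  rewrite -monotone_convergence//.
  by apply: eq_integral => x _; apply/esym/cvg_lim.
have cl : cvgn (fun k => \int[Pi]_x (h k x)%:E)%E.
  apply: ereal_nondecreasing_is_cvgn => a b ab; apply: ge0_le_integral => //.
  by move=> x _; exact: nd.
rewrite -limeMl//; apply: lime_le; first by apply: is_cvgeMl.
by apply: nearW => k; exact: hk.
Unshelve. all: by end_near. Qed.

Lemma wasserstein_mixture :
  (wasserstein rho mu Pi = s%:E * \int[Pi]_x (rho x x0)%:E)%E.
Proof.
apply/eqP; rewrite eq_le; apply/andP; split.
  apply: ereal_inf_lbound; exists mixture_coupling.
    exact: coupling_mixture.
  exact: mixture_coupling_cost.
apply/ereal_infP => _ [xi cxi <-]; exact: coupling_cost_lower_bound.
Qed.

End wasserstein_mixture.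

(** * Bayesian generalized linear models *)

Section distribution_probability.
Variables (R : realType) (d : nat) (f : 'cV[R]_d -> R).
Hypotheses (mf : measurable_fun setT f) (f0 : forall x, 0 <= f x).
Hypothesis f1 : (\int[lebesgue_cV R d]_x (f x)%:E = 1)%E.

Let D : set 'cV[R]_d -> \bar R := distribution_measure mf f0.

HB.instance Definition _ := Measure.on D.
HB.instance Definition _ := @Measure_isProbability.Build _ _ R D f1.

Definition distribution_probability : probability 'cV[R]_d R := D.

End distribution_probability.

(** The hypothesis reads 0 <= t (D + t a q2 / 2) with D = L1 - L0 + a q1, and letting t tend to 0
    would give D >= 0. One explicit [t] replaces the limit. *)
Lemma first_order_optimality (F : realFieldType) (a L0 L1 q0 q1 q2 : F) :
  0 < a -> 0 <= q2 ->
  (forall t, 0 < t -> t <= 1 -> L0 + a / 2 * q0 <=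
     (1 - t) * L0 + t * L1 + a / 2 * (q0 + 2 * t * q1 + t ^+ 2 * q2)) ->
  L0 - a * q1 <= L1.
Proof.
move=> a0 q2_ge0 opt; rewrite -subr_ge0 leNgt; apply/negP.
set D := _ - _ => D0.
have aq0 : 0 <= a * q2 by rewrite mulr_ge0// ltW.
have den : 0 < - D + a * q2 by rewrite ltr_wpDr// oppr_gt0.
(* The denominator ensures both t <= 1 and t a q2 <= - D, so that D + t a q2 / 2 <= D / 2 < 0. *)
pose t := - D / (- D + a * q2).
have t0 : 0 < t by rewrite divr_gt0// oppr_gt0.
have t1 : t <= 1 by rewrite ler_pdivrMr// mul1r lerDl.
have tE : t * (- D + a * q2) = - D by rewrite divfK// gt_eqF.
have tq : t * (a * q2) <= - D by rewrite -tE ler_pM2l// lerDr oppr_ge0 ltW.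
have : 0 <= t * (D + t * (a * q2) / 2).
  rewrite (_ : _ * _ = (1 - t) * L0 + t * L1 +
    a / 2 * (q0 + 2 * t * q1 + t ^+ 2 * q2) - (L0 + a / 2 * q0)).
    by rewrite subr_ge0 opt.
  by rewrite /D; field.
by rewrite pmulr_rge0// leNgt => /negP; apply; lra.
Qed.

Section posterior.
Variables (R : realType) (g : glm R) (n d : nat).
Variables (X : 'I_n -> 'cV[R]_d) (Y : 'I_n -> response g).
Variables (alpha : R) (C : 'M[R]_d).
Hypotheses (alpha_gt0 : 0 < alpha) (C_sym : C^T = C) (C_pos_def : pos_def C).
Local Notation kern := (posterior_kernel X Y alpha C).
Local Notation pdf := (posterior_pdf X Y alpha C).
Local Notation Z := (posterior_Z X Y alpha C).
Local Notation Q u v := (dotv u (invmx C *m v)).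

Lemma posterior_kernel_gt0 b : 0 < kern b.
Proof. exact: expR_gt0. Qed.

Lemma measurable_posterior_kernel : measurable_fun setT kern.
Proof.
apply: measurableT_comp => //; apply: measurable_funB.
  apply: measurableT_comp => //; exact: measurable_nll.
by apply: measurable_funM => //; exact: measurable_quadratic.
Qed.

(** Substitute for the equation grad l(b) = - alpha C^-1 b: compare [b] with points of the segment
    towards [y], bounding [nll] there by its chord and expanding the quadratic form. *)
Lemma nll_tangent_at_max b y : (forall b', kern b' <= kern b) ->
  nll X Y b - alpha * Q (y - b) b <= nll X Y y.
Proof.
(* An opaque name for [y - b], which the bilinear expansion below would otherwise split. *)
move=> bmax; have [h hE] : exists h, h = y - b by exists (y - b).
rewrite -hE; apply: (@first_order_optimality _ alpha _ _ (Q b b) _ (Q h h)) => //.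
  have [->|h0] := eqVneq h 0; first by rewrite mulmx0 /dotv mulmx0 mxE.
  exact/ltW/(pos_def_invmx C_sym C_pos_def).
move=> t t0 t1; have := bmax (b + t *: h); rewrite ler_expR.
have := nll_convex X Y b y (ltW t0) t1; rewrite -hE.
have -> : Q (b + t *: h) (b + t *: h) = Q b b + 2 * t * Q h b + t ^+ 2 * Q h h.
  rewrite mulmxDr -scalemxAr !(dotvDl, dotvDr, dotvZl, dotvZr).
  by rewrite (dotv_sym b h (invmx_sym C_sym)); ring.
by move: (nll X Y _) (_ + t * _) (_ + _ + _) => N u v h1; rewrite -!opprD lerN2; lra.
Qed.

End posterior.

(* If the kernel were not integrable, [posterior_Z] would be [0] and the density
   identically [0]; uniqueness of the maximizer then leaves only [d = 0]. *)
Lemma posterior_Z_gt0 (R : realType) (g : glm R) (n d : nat)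
    (X : 'I_n -> 'cV[R]_d) (Y : 'I_n -> response g) (alpha : R) (C : 'M[R]_d) b :
  unique (fun b : 'cV[R]_d => forall b' : 'cV[R]_d,
    posterior_pdf X Y alpha C b' <= posterior_pdf X Y alpha C b) b ->
  0 < posterior_Z X Y alpha C.
Proof.
move=> [_ bu]; have Z0 : 0 <= posterior_Z X Y alpha C.
  rewrite fine_ge0// integral_ge0// => x _.
  by rewrite lee_fin ltW// posterior_kernel_gt0.
rewrite lt_def Z0 andbT; apply/eqP => Ze.
have allb x : b = x.
  by apply: bu => y; rewrite /posterior_pdf Ze invr0 !mul0r.
case: d X C b bu Z0 Ze allb => [|d] X C b _ _ Ze allb.
  have mk := measurable_posterior_kernel X Y alpha C.
  have := posterior_kernel_gt0 X Y alpha C 0.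
  move: Ze; rewrite /posterior_Z /Rintegral integral_dirac//; last first.
    exact/measurable_EFinP.
  by rewrite diracT mul1e /= => ->; rewrite ltxx.
have := allb 0; rewrite (allb (const_mx 1)) => /matrixP /(_ ord0 ord0).
by rewrite !mxE => /eqP; rewrite oner_eq0.
Qed.

Theorem corollary1 (R : realType) (g : glm R) (n d : nat)
    (X : 'I_n -> 'cV[R]_d) (Y : 'I_n -> response g)
    (alpha : R) (C : 'M[R]_d) (beta_star : 'cV[R]_d)
    (alpha_gt0 : 0 < alpha) (C_sym : C^T = C) (C_pos_def : pos_def C)
    (beta_star_max : unique (fun b : 'cV[R]_d => forall b' : 'cV[R]_d,
        posterior_pdf X Y alpha C b' <= posterior_pdf X Y alpha C b) beta_star) :
  let Pi := distribution_of (posterior_pdf X Y alpha C) in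
  let q := mvnormal_pdf beta_star (alpha^-1 *: C) in
  let P := mhi_kernel (posterior_pdf X Y alpha C) q in
  let eps := expR (nll X Y beta_star +
                   alpha / 2 * dotv beta_star (invmx C *m beta_star)) *
             posterior_Z X Y alpha C /
             ((2 * pi) `^ (d%:R / 2) * Num.sqrt (\det (alpha^-1 *: C))) in
  (exists2 B : set 'cV[R]_d, measurable B & distribution_of q B <> Pi B) ->
  forall rho : 'cV[R]_d -> 'cV[R]_d -> R, lsc_metric rho ->
  forall t : nat, (1 <= t)%N ->
    wasserstein rho (kernel_iter P t beta_star) Pi =
    (((1 - eps) ^+ t)%:E * \int[Pi]_b (rho b beta_star)%:E)%E.
Proof.
move=> Pi q P eps _ rho [rho_metric rho_lsc] t _.
set p := posterior_pdf X Y alpha C in Pi P beta_star_max *.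
have Z_gt0 := posterior_Z_gt0 beta_star_max.
set Z := posterior_Z X Y alpha C in eps Z_gt0 *.
pose S := alpha^-1 *: C.
have S_sym : S^T = S by rewrite linearZ/= C_sym.
have S_pd : pos_def S by apply: pos_defZ => //; rewrite invr_gt0.
have S_inv : invmx S = alpha *: invmx C.
  by rewrite invmxZ ?invrK// unitmxZ ?pos_def_unitmx// unitfE invr_eq0 gt_eqF.
have N_gt0 := mvnormal_norm_gt0 S_sym S_pd.
have p_gt0 x : 0 < p x by rewrite mulr_gt0 ?invr_gt0// posterior_kernel_gt0.
have mk := measurable_posterior_kernel X Y alpha C.
have mp : measurable_fun setT p by apply: measurable_funM.
have p_int : (\int[lebesgue_cV R d]_x (p x)%:E = 1)%E.
  rewrite /p /posterior_pdf; under eq_integral do rewrite EFinM.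
  rewrite ge0_integralZl//; last 3 first.
  - exact/measurable_EFinP.
  - by move=> x _; rewrite lee_fin ltW// posterior_kernel_gt0.
  - by rewrite lee_fin invr_ge0 ltW.
  (* An infinite integral would have real value 0, which [Z_gt0] excludes. *)
  have ZE : (\int[lebesgue_cV R d]_x (posterior_kernel X Y alpha C x)%:E = Z%:E)%E.
    move: Z_gt0; rewrite /Z /posterior_Z /Rintegral.
    by case: (integral _ _ _) => [r| |]//=; rewrite ltxx.
  by rewrite ZE -EFinM mulVf// gt_eqF.
have q_gt0 x : 0 < q x by exact: mvnormal_pdf_gt0.
have mq : measurable_fun setT q by exact: measurable_mvnormal_pdf.
have q_int : (\int[lebesgue_cV R d]_x (q x)%:E = 1)%E by exact: integral_mvnormal_pdf.
have kmax b : posterior_kernel X Y alpha C b <= posterior_kernel X Y alpha C beta_star.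
  by have := beta_star_max.1 b; rewrite /p ler_pM2l// invr_gt0.
have pE : p beta_star = (Z * expR (nll X Y beta_star +
    alpha / 2 * dotv beta_star (invmx C *m beta_star)))^-1.
  by rewrite /p /posterior_pdf /posterior_kernel -opprD expRN invfM.
have epsE : q beta_star / p beta_star = eps.
  rewrite /q /mvnormal_pdf subrr mulmx0 {1}/dotv mulmx0 mxE mul0r oppr0 expR0 mulr1.
  by rewrite pE invrK mulrC /eps (mulrC Z).
(* Once [Z] and the Gaussian normalization cancel, comparing exponents gives exactly the tangent
   inequality at the mode: the terms quadratic in [y] drop out. *)
have eps_min y : q beta_star / p beta_star * p y <= q y.
  rewrite epsE /eps /q /mvnormal_pdf -/S; set N := _ * Num.sqrt _.
  rewrite mulrAC -[leRHS]mulrC ler_pM2r ?invr_gt0//.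
  rewrite -[leLHS]mulrA (_ : Z * p y = posterior_kernel X Y alpha C y); last first.
    by apply: mulVKf; rewrite gt_eqF.
  rewrite /posterior_kernel -expRD ler_expR S_inv -scalemxAl dotvZr.
  have := nll_tangent_at_max alpha_gt0 C_sym C_pos_def y kmax.
  rewrite mulmxBr !(dotvBl, dotvBr) (dotv_sym beta_star y (invmx_sym C_sym)).
  move: (nll X Y beta_star) (nll X Y y) (dotv y _) (dotv y _) (dotv beta_star _).
  by move=> L0 L1 qyy qyb qbb; rewrite -subr_ge0 => tangent; rewrite -subr_ge0;
    apply: le_trans tangent _; rewrite le_eqVlt; apply/orP; left; apply/eqP; field.
have s0 : 0 <= (1 - eps) ^+ t.
  by rewrite exprn_ge0// -epsE subr_ge0 (ratio_min_le1 _ _ mp mq).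
have s1 : (1 - eps) ^+ t <= 1.
  rewrite exprn_ile1// -epsE ?subr_ge0 ?(ratio_min_le1 _ _ mp mq)//.
  by rewrite lerBlDr lerDl ratio_min_ge0.
pose PiP := distribution_probability mp (fun x => ltW (p_gt0 x)) p_int.
have muE B : measurable B -> kernel_iter P t beta_star B =
    ((1 - (1 - eps) ^+ t)%:E * PiP B + ((1 - eps) ^+ t)%:E * \d_beta_star B)%E.
  move=> mB; rewrite -epsE.
  exact: (kernel_iter_ratio_min p_gt0 q_gt0 mp mq p_int q_int eps_min).
have := wasserstein_mixture rho_metric (measurable_lsc_cVX rho_lsc) s0 s1 muE.
exact.
Qed.
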